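(* Let $\Omega\subseteq\mathbb{H}$ be a symmetric slice domain and let $f:\Omega\to\mathbb{H}$ be a regular function. If $|f|$ has a local minimum point $p\in\Omega$, then either $f(p)=0$ or $f$ is constant.
   Context: $\mathbb{H}$ is the real algebra of quaternions, with modulus $|\cdot|$; $\mathbb{S}=\{q\in\mathbb{H}: q^2=-1\}$ is the 2-sphere of imaginary units, and for $I\in\mathbb{S}$, $L_I=\mathbb{R}+I\mathbb{R}\simeq\mathbb{C}$. For $x,y\in\mathbb{R}$, $x+y\mathbb{S}=\{x+yJ: J\in\mathbb{S}\}$. A domain is a connected open set. For a domain $\Omega\subseteq\mathbb{H}$ put $\Omega_I=\Omega\cap L_I$. A function $f:\Omega\to\mathbb{H}$ on a domain $\Omega\subseteq\mathbb{H}$ is (slice) regular if for every $I\in\mathbb{S}$ the restriction $f_I=f|_{\Omega_I}$ is holomorphic, meaning $f_I\in C^1(\Omega_I)$ and $\frac12\left(\frac{\partial}{\partial x}+I\frac{\partial}{\partial y}\right)f_I(x+Iy)=0$ on $\Omega_I$. A slice domain is a domain $\Omega\subseteq\mathbb{H}$ intersecting the real axis such that $\Omega_I$ is a domain in $L_I$ for all $I\in\mathbb{S}$. A set $C\subseteq\mathbb{H}$ is (axially) symmetric if for all $x+yI\in C$ with $x,y\in\mathbb{R}$, $I\in\mathbb{S}$, the whole set $x+y\mathbb{S}$ is contained in $C$. *)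

(* Defs.v *)
From HB Require Import structures.
From mathcomp Require Import all_boot all_order all_algebra.
From mathcomp Require Import all_classical all_reals all_analysis.
From mathcomp Require Import ring.

Set Implicit Arguments.
Unset Strict Implicit.
Unset Printing Implicit Defensive.

Import Order.TTheory GRing.Theory Num.Theory.
Import numFieldTopology.Exports numFieldNormedType.Exports.

Local Open Scope classical_set_scope.
Local Open Scope ring_scope.

(* a + b i + c j + d k is the row (a, b, c, d).  The type inherits from
   'rV[R]_4 its topology (that of R^4), its vector space structure and its
   sup norm `|q|; the Euclidean modulus of a quaternion is qmod below. *)
Definition quat (R : realType) : Type := 'rV[R]_4.

HB.instance Definition _ (R : realType) := NormedModule.on (quat R).

Section QuatAlgebra.
Variable R : realType.
Implicit Types p q r : quat R.

Definition mkquat (a b c d : R) : quat R := \row_(i < 4) [:: a; b; c; d]`_i.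

Definition qre q : R := q ord0 (@Ordinal 4 0 isT).
Definition qi q : R := q ord0 (@Ordinal 4 1 isT).
Definition qj q : R := q ord0 (@Ordinal 4 2 isT).
Definition qk q : R := q ord0 (@Ordinal 4 3 isT).

Definition qone : quat R := mkquat 1 0 0 0.

Definition qmul p q : quat R := mkquat
  (qre p * qre q - qi p * qi q - qj p * qj q - qk p * qk q)
  (qre p * qi q + qi p * qre q + qj p * qk q - qk p * qj q)
  (qre p * qj q - qi p * qk q + qj p * qre q + qk p * qi q)
  (qre p * qk q + qi p * qj q - qj p * qi q + qk p * qre q).

Lemma quatP p q :
  qre p = qre q -> qi p = qi q -> qj p = qj q -> qk p = qk q -> p = q.
Proof.
move=> e0 e1 e2 e3; apply/rowP => -[[|[|[|[|//]]]] lti].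
- by move: e0; rewrite /qre (bool_irrelevance lti isT).
- by move: e1; rewrite /qi (bool_irrelevance lti isT).
- by move: e2; rewrite /qj (bool_irrelevance lti isT).
- by move: e3; rewrite /qk (bool_irrelevance lti isT).
Qed.

Lemma mkquatE a b c d : (qre (mkquat a b c d) = a) * (qi (mkquat a b c d) = b)
  * (qj (mkquat a b c d) = c) * (qk (mkquat a b c d) = d).
Proof. by rewrite /qre /qi /qj /qk !mxE. Qed.

Lemma quatDE p q : (qre (p + q) = qre p + qre q) * (qi (p + q) = qi p + qi q)
  * (qj (p + q) = qj p + qj q) * (qk (p + q) = qk p + qk q).
Proof. by rewrite /qre /qi /qj /qk !mxE. Qed.

Lemma quatZE (a : R) p : (qre (a *: p) = a * qre p) * (qi (a *: p) = a * qi p)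
  * (qj (a *: p) = a * qj p) * (qk (a *: p) = a * qk p).
Proof. by rewrite /qre /qi /qj /qk !mxE. Qed.

Lemma qmulA : associative qmul.
Proof. by move=> p q r; apply: quatP; rewrite !mkquatE; ring. Qed.

Lemma qmul1q : left_id qone qmul.
Proof. by move=> p; apply: quatP; rewrite !mkquatE; ring. Qed.

Lemma qmulq1 : right_id qone qmul.
Proof. by move=> p; apply: quatP; rewrite !mkquatE; ring. Qed.

Lemma qmulDl : left_distributive qmul +%R.
Proof. by move=> p q r; apply: quatP; rewrite !(mkquatE, quatDE); ring. Qed.

Lemma qmulDr : right_distributive qmul +%R.
Proof. by move=> p q r; apply: quatP; rewrite !(mkquatE, quatDE); ring. Qed.

Lemma qone_neq0 : qone != 0 :> quat R.
Proof.
apply/eqP => /(congr1 qre); rewrite mkquatE /qre mxE.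
by apply/eqP; exact: oner_neq0.
Qed.

HB.instance Definition _ := GRing.Zmodule_isNzRing.Build (quat R)
  qmulA qmul1q qmulq1 qmulDl qmulDr qone_neq0.

Lemma qscaleAl (a : R) p q : a *: (p * q) = (a *: p) * q.
Proof. by apply: quatP; rewrite !(mkquatE, quatZE); ring. Qed.

Lemma qscaleAr (a : R) p q : a *: (p * q) = p * (a *: q).
Proof. by apply: quatP; rewrite !(mkquatE, quatZE); ring. Qed.

HB.instance Definition _ := GRing.Lmodule_isLalgebra.Build R (quat R) qscaleAl.
HB.instance Definition _ := GRing.Lalgebra_isAlgebra.Build R (quat R) qscaleAr.

End QuatAlgebra.

Section SliceRegular.
Variable R : realType.
Implicit Types (I J p q : quat R) (Omega C : set (quat R)).
Implicit Types (f : quat R -> quat R).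

Definition qmod q : R :=
  Num.sqrt (qre q ^+ 2 + qi q ^+ 2 + qj q ^+ 2 + qk q ^+ 2).

Definition imag_units : set (quat R) := [set q | q ^+ 2 = -1].

Definition slice_pt I (z : R * R) : quat R := z.1%:A + z.2 *: I.

Definition slice_plane I : set (quat R) := range (slice_pt I).

Definition is_domain (T : topologicalType) (A : set T) : Prop :=
  open A /\ connected A.

(* The subspace topology makes "domain" relative to the plane L_I. *)
Definition slice_domain Omega : Prop :=
  [/\ is_domain Omega,
      exists x : R, Omega x%:A &
      forall I, imag_units I ->
        @is_domain (subspace (slice_plane I)) (Omega `&` slice_plane I)].

Definition axially_symmetric C : Prop :=
  forall (x y : R) I, imag_units I -> C (slice_pt I (x, y)) ->
  forall J, imag_units J -> C (slice_pt J (x, y)).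

(* f_I in the real coordinates (x, y) of L_I, and its partial derivatives. *)
Definition slice_restr f I : R * R -> quat R := f \o slice_pt I.

Definition dx (g : R * R -> quat R) (z : R * R) : quat R := 'D_(1, 0) g z.
Definition dy (g : R * R -> quat R) (z : R * R) : quat R := 'D_(0, 1) g z.

Definition C1_on (U : set (R * R)) (g : R * R -> quat R) : Prop :=
  forall z, U z ->
    [/\ derivable g z (1, 0), derivable g z (0, 1),
        {for z, continuous (dx g)} & {for z, continuous (dy g)}].

(* A function Omega -> H is represented by a total function whose values
   outside Omega are irrelevant: Omega being open, the derivatives at points
   of Omega depend only on the restriction to Omega. *)
Definition slice_regular Omega f : Prop :=
  forall I, imag_units I ->
    C1_on (slice_pt I @^-1` Omega) (slice_restr f I) /\
    forall z, Omega (slice_pt I z) ->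
      (2^-1 : R) *: (dx (slice_restr f I) z + I * dy (slice_restr f I) z) = 0.

Definition local_min_on Omega (h : quat R -> R) p : Prop :=
  Omega p /\ \forall q \near p, Omega q -> h p <= h q.

Definition constant_on Omega f : Prop :=
  exists c : quat R, forall q, Omega q -> f q = c.

End SliceRegular.

(* Main.v *)
Require Import Defs.
From HB Require Import structures.
From mathcomp Require Import all_boot all_order all_algebra.
From mathcomp Require Import all_classical all_reals all_analysis.
From mathcomp Require Import ring lra.
Import Order.TTheory GRing.Theory Num.Theory.
Import numFieldTopology.Exports numFieldNormedType.Exports.
Local Open Scope classical_set_scope.
Local Open Scope ring_scope.

(** The idea is that the reciprocal of [f] turns a minimum of [|f|] into a maximum.
    Quaternionic values do not commute, so the reciprocal has to be taken in the
    sense of slice functions, and three facts make this work.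

    Representation formula ([representation]).  On the symmetric domain,
    [f (x + y J) = B (x, y) + J * C (x, y)] for all imaginary units [J], where
    [(B, C)] satisfies the Cauchy-Riemann equations.  Both sides are holomorphic
    on the slice of [J] and agree on the real axis, so they are equal by the
    identity principle.

    Reciprocal ([twist_mul]).  Let [G = B' + J * C'] be built from the conjugates
    of [B] and [C], and let [N], the symmetrization, be
    [|B| ^ 2 - |C| ^ 2 + 2 <B, C> J].  Then [G^-1 * N] is the value of [f] at
    the point [x + y K], [K = G^-1 * J * G].  If [f p != 0], a suitable [J] makes
    [K] the unit of [p], and [H = N^-1 * G], which is holomorphic on the slice of
    [J], has a local maximum of its modulus, provided that [N] is not zero there.
    That is where the minimum over the sphere through [p] enters
    ([sphere_decrease]): were [N] zero, [f] would vanish somewhere on the sphere,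
    and [|f|] could be decreased from any other point of it.

    Maximum principle ([strong_maximum], [identity_principle]).  Thus [H] is
    constant near the given point, [G] is [N] times a constant on the whole slice,
    and comparing conjugate points forces [C = 0] and [B] constant.

    The complex analysis is derived from one estimate, the discrete mean value
    property [circle_sum_le]: the average of a holomorphic function over the
    vertices of a regular polygon tends to its value at the centre.  It gives the
    strong maximum principle by a variance argument.  Applied to
    [(z - c) ^- n * g], the maximum principle shows that [g] vanishes as soon as
    it vanishes on the part of the boundary of a region that is not on a circle
    about the outside point [c] ([vanish_polar]); annuli and circular caps then
    yield uniqueness from an open set and from a real segment, without power
    series. *)

Set Implicit Arguments.
Unset Strict Implicit.
Unset Printing Implicit Defensive.

(** * Quaternion algebra *)

Section QuatBasics.
Variable R : realType.
Implicit Types p q r J : quat R.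

Definition qconj q : quat R := mkquat (qre q) (- qi q) (- qj q) (- qk q).
Definition qdot p q : R :=
  qre p * qre q + qi p * qi q + qj p * qj q + qk p * qk q.
Definition qnsq q : R := qdot q q.
Definition qinv q : quat R := (qnsq q)^-1 *: qconj q.

Lemma quat1E : (qre (1 : quat R) = 1) * (qi (1 : quat R) = 0)
  * (qj (1 : quat R) = 0) * (qk (1 : quat R) = 0).
Proof. exact: mkquatE. Qed.

Lemma quat0E : (qre (0 : quat R) = 0) * (qi (0 : quat R) = 0)
  * (qj (0 : quat R) = 0) * (qk (0 : quat R) = 0).
Proof. by rewrite /qre /qi /qj /qk !mxE. Qed.

Lemma quatNE p : (qre (- p) = - qre p) * (qi (- p) = - qi p)
  * (qj (- p) = - qj p) * (qk (- p) = - qk p).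
Proof. by rewrite /qre /qi /qj /qk !mxE. Qed.

Lemma quatME p q :
  (qre (p * q) = qre p * qre q - qi p * qi q - qj p * qj q - qk p * qk q)
  * (qi (p * q) = qre p * qi q + qi p * qre q + qj p * qk q - qk p * qj q)
  * (qj (p * q) = qre p * qj q - qi p * qk q + qj p * qre q + qk p * qi q)
  * (qk (p * q) = qre p * qk q + qi p * qj q - qj p * qi q + qk p * qre q).
Proof. exact: mkquatE. Qed.

Definition quatE := (quat1E, quat0E, quatNE, quatDE, quatZE, quatME, mkquatE).

Lemma qconjE p : (qre (qconj p) = qre p) * (qi (qconj p) = - qi p)
  * (qj (qconj p) = - qj p) * (qk (qconj p) = - qk p).
Proof. exact: mkquatE. Qed.

Lemma qconjD p q : qconj (p + q) = qconj p + qconj q.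
Proof. by apply: quatP; rewrite !(qconjE, quatE); ring. Qed.

Lemma qconjN p : qconj (- p) = - qconj p.
Proof. by apply: quatP; rewrite !(qconjE, quatE); ring. Qed.

Lemma qconjM p q : qconj (p * q) = qconj q * qconj p.
Proof. by apply: quatP; rewrite !(qconjE, quatE); ring. Qed.

Lemma qconjK : involutive qconj.
Proof. by move=> p; apply: quatP; rewrite !(qconjE, quatE); ring. Qed.

Lemma qmul_conj q : q * qconj q = (qnsq q)%:A.
Proof. by apply: quatP; rewrite !(qconjE, quatE) /qnsq /qdot; ring. Qed.

Lemma qconj_mul q : qconj q * q = (qnsq q)%:A.
Proof. by apply: quatP; rewrite !(qconjE, quatE) /qnsq /qdot; ring. Qed.

Lemma qnsqM p q : qnsq (p * q) = qnsq p * qnsq q.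
Proof. by rewrite /qnsq /qdot !quatE; ring. Qed.

Lemma qnsqZ (a : R) p : qnsq (a *: p) = a ^+ 2 * qnsq p.
Proof. by rewrite /qnsq /qdot !quatE; ring. Qed.

Lemma qnsqD p q : qnsq (p + q) = qnsq p + 2 * qdot p q + qnsq q.
Proof. by rewrite /qnsq /qdot !quatE; ring. Qed.

Lemma qnsqB p q : qnsq (p - q) = qnsq p - 2 * qdot p q + qnsq q.
Proof. by rewrite /qnsq /qdot !quatE; ring. Qed.

Lemma qnsq_conj q : qnsq (qconj q) = qnsq q.
Proof. by rewrite /qnsq /qdot !qconjE; ring. Qed.

Lemma qnsq_ge0 q : 0 <= qnsq q.
Proof. by rewrite /qnsq /qdot -!expr2 !addr_ge0 ?sqr_ge0. Qed.

Lemma qnsq0 : qnsq 0 = 0.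
Proof. by rewrite /qnsq /qdot !quatE; ring. Qed.

Lemma qnsq1 : qnsq 1 = 1.
Proof. by rewrite /qnsq /qdot !quatE; ring. Qed.

Lemma qnsq_eq0 q : (qnsq q == 0) = (q == 0).
Proof.
apply/idP/eqP => [|->]; last by rewrite qnsq0.
rewrite /qnsq /qdot -!expr2 !paddr_eq0 ?addr_ge0 ?sqr_ge0 // !sqrf_eq0.
move=> /andP[/andP[/andP[/eqP a /eqP b] /eqP c] /eqP d].
by apply: quatP; rewrite !quatE.
Qed.

Lemma qmodE q : qmod q = Num.sqrt (qnsq q).
Proof. by rewrite /qmod /qnsq /qdot -!expr2. Qed.

Lemma qmod_sqr q : qmod q ^+ 2 = qnsq q.
Proof. by rewrite qmodE sqr_sqrtr // qnsq_ge0. Qed.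

Lemma qmod_ge0 q : 0 <= qmod q.
Proof. by rewrite qmodE sqrtr_ge0. Qed.

Lemma qmodM p q : qmod (p * q) = qmod p * qmod q.
Proof. by rewrite !qmodE qnsqM sqrtrM // qnsq_ge0. Qed.

Lemma qmodZ (a : R) p : qmod (a *: p) = `|a| * qmod p.
Proof. by rewrite !qmodE qnsqZ sqrtrM ?sqr_ge0 // sqrtr_sqr. Qed.

Lemma qmodN p : qmod (- p) = qmod p.
Proof. by rewrite -scaleN1r qmodZ normrN1 mul1r. Qed.

Lemma qmodBC p q : qmod (p - q) = qmod (q - p).
Proof. by rewrite -qmodN opprB. Qed.

Lemma qmod_conj p : qmod (qconj p) = qmod p.
Proof. by rewrite !qmodE qnsq_conj. Qed.

Lemma qmod0 : qmod (0 : quat R) = 0.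
Proof. by rewrite qmodE qnsq0 sqrtr0. Qed.

Lemma qmod1 : qmod (1 : quat R) = 1.
Proof. by rewrite qmodE qnsq1 sqrtr1. Qed.

Lemma qmod_eq0 q : (qmod q == 0) = (q == 0).
Proof. by rewrite -qnsq_eq0 -qmod_sqr sqrf_eq0. Qed.

Lemma qmod_gt0 q : (0 < qmod q) = (q != 0).
Proof. by rewrite lt_def qmod_ge0 qmod_eq0 andbT. Qed.

Lemma qmod_le p q : (qmod p <= qmod q) = (qnsq p <= qnsq q).
Proof. by rewrite !qmodE ler_sqrt // qnsq_ge0. Qed.

(** Lagrange's identity: the defect in the Cauchy-Schwarz inequality is the
    squared modulus of the imaginary part of [p * qconj q]. *)
Lemma qdot_le p q : qdot p q <= qmod p * qmod q.
Proof.
apply: le_trans (ler_norm _) _.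
rewrite -ler_sqr ?nnegrE ?mulr_ge0 ?qmod_ge0 //.
rewrite real_normK ?num_real // exprMn !qmod_sqr -subr_ge0.
have -> : qnsq p * qnsq q - qdot p q ^+ 2 =
    qi (p * qconj q) ^+ 2 + qj (p * qconj q) ^+ 2 + qk (p * qconj q) ^+ 2.
  by rewrite /qnsq /qdot !(qconjE, quatE); ring.
by rewrite !addr_ge0 ?sqr_ge0.
Qed.

Lemma qmodD p q : qmod (p + q) <= qmod p + qmod q.
Proof.
rewrite -ler_sqr ?nnegrE ?addr_ge0 ?qmod_ge0 //.
rewrite sqrrD !qmod_sqr qnsqD lerD2r lerD2l mulr_natl ler_pMn2r //.
exact: qdot_le.
Qed.

Lemma qmodB_le p q : qmod (p - q) <= qmod p + qmod q.
Proof. by rewrite -[qmod q]qmodN qmodD. Qed.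

Lemma qmod_sum n (F : 'I_n -> quat R) : qmod (\sum_i F i) <= \sum_i qmod (F i).
Proof.
apply: (big_ind2 (fun x y => qmod x <= y)) => //; first by rewrite qmod0.
by move=> x1 x2 y1 y2 h1 h2; apply: le_trans (qmodD _ _) (lerD h1 h2).
Qed.

Lemma qmulV q : q != 0 -> q * qinv q = 1.
Proof.
move=> q0; rewrite /qinv -scalerAr qmul_conj scalerA mulVf ?qnsq_eq0 //.
exact: scale1r.
Qed.

Lemma qmulVl q : q != 0 -> qinv q * q = 1.
Proof.
move=> q0; rewrite /qinv -scalerAl qconj_mul scalerA mulVf ?qnsq_eq0 //.
exact: scale1r.
Qed.

Lemma qmod_inv q : qmod (qinv q) = (qmod q)^-1.
Proof.
have [->|q0] := eqVneq q 0.
  by rewrite /qinv qnsq0 invr0 scale0r qmod0 invr0.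
have /(congr1 (@qmod R)) := qmulV q0; rewrite qmodM qmod1 => e.
by apply: (mulfI (_ : qmod q != 0)); rewrite ?qmod_eq0 // e divff // qmod_eq0.
Qed.

(** From [J ^+ 2 = -1] the modulus of [J] is 1, and then the real part of
    [J ^+ 2 + qnsq J = 0] reads [2 * qre J ^+ 2 = 0]. *)
Lemma imag_unitP J : imag_units J <-> qre J = 0 /\ qnsq J = 1.
Proof.
rewrite /imag_units /=; split=> [/eqP|[J0 J1]].
  rewrite expr2 => /eqP JJ.
  have /(congr1 qnsq) := JJ; rewrite qnsqM -scaleN1r qnsqZ qnsq1 mulr1 sqrrN.
  rewrite expr1n -expr2 => /eqP; rewrite sqrf_eq1 => /orP[/eqP n1|/eqP n1]; last first.
    by have := qnsq_ge0 J; rewrite n1 oppr_ge0 ler10.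
  split=> //; move: (congr1 (@qre _) JJ); rewrite !quatE => e.
  move: n1; rewrite /qnsq /qdot => n1.
  have : qre J ^+ 2 = 0 by lra.
  by move/eqP; rewrite sqrf_eq0 => /eqP.
have cJ : qconj J = - J by apply: quatP; rewrite !(qconjE, quatE) ?J0 ?oppr0.
by rewrite expr2 -[X in _ * X]opprK -cJ mulrN qmul_conj J1 scale1r.
Qed.

Lemma imag_unit_conj J : imag_units J -> qconj J = - J.
Proof.
by move/imag_unitP=> [J0 _]; apply: quatP; rewrite !(qconjE, quatE) ?J0 ?oppr0.
Qed.

Lemma imag_unit_mul J : imag_units J -> J * J = -1.
Proof. by rewrite /imag_units /= expr2. Qed.

Lemma imag_unit_mod J : imag_units J -> qmod J = 1.
Proof. by move/imag_unitP=> [_ J1]; rewrite qmodE J1 sqrtr1. Qed.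

Lemma imag_unitN J : imag_units J -> imag_units (- J).
Proof. by rewrite /imag_units /= sqrrN. Qed.

Lemma imag_unit_conjg q J : q != 0 -> imag_units J ->
  imag_units (q * J * qinv q).
Proof.
move=> q0 /imag_unit_mul JJ; rewrite /imag_units /= expr2.
rewrite !mulrA -(mulrA _ (qinv q) q) qmulVl // mulr1 -(mulrA q) JJ.
by rewrite mulrN1 mulNr qmulV.
Qed.

Lemma slice_ptE J (z : R * R) : slice_pt J z = z.1%:A + z.2 *: J.
Proof. by []. Qed.

Lemma slice_ptB J (z w : R * R) : slice_pt J (z - w) = slice_pt J z - slice_pt J w.
Proof. by rewrite !slice_ptE /= !scalerBl opprD addrACA. Qed.

Lemma slice_ptM J (z w : R * R) : imag_units J ->
  slice_pt J z * slice_pt J w =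
  slice_pt J (z.1 * w.1 - z.2 * w.2, z.1 * w.2 + z.2 * w.1).
Proof.
move=> /imag_unit_mul JJ; rewrite !slice_ptE /=.
rewrite mulrDl !mulrDr -!scalerAl -!scalerAr !mul1r !mulr1 JJ !scalerA.
rewrite scalerN scalerBl scalerDl (mulrC z.2 w.1) [RHS]addrAC.
by rewrite -!addrA; congr (_ + _); rewrite [RHS]addrCA [RHS]addrA.
Qed.

Lemma qnsq_slice J (z : R * R) : imag_units J ->
  qnsq (slice_pt J z) = z.1 ^+ 2 + z.2 ^+ 2.
Proof.
move=> /imag_unitP[J0]; rewrite /qnsq /qdot !slice_ptE !quatE J0 => J1.
set j := (X in X = 1) in J1; transitivity (z.1 ^+ 2 + z.2 ^+ 2 * j).
  by rewrite /j; ring.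
by rewrite J1 mulr1.
Qed.

Lemma coord_le_qmod q i : `|q ord0 i| <= qmod q.
Proof.
rewrite -ler_sqr ?nnegrE ?qmod_ge0 // qmod_sqr real_normK ?num_real //.
have := (sqr_ge0 (qre q), sqr_ge0 (qi q), sqr_ge0 (qj q), sqr_ge0 (qk q)).
rewrite /qnsq /qdot -!expr2 => -[[[h0 h1] h2] h3].
case: i => -[|[|[|[|//]]]] lti; rewrite (bool_irrelevance lti isT).
- change (q ord0 _) with (qre q); lra.
- change (q ord0 _) with (qi q); lra.
- change (q ord0 _) with (qj q); lra.
- change (q ord0 _) with (qk q); lra.
Qed.

Lemma qmod_le_sum q : qmod q <= `|qre q| + `|qi q| + `|qj q| + `|qk q|.
Proof.
rewrite -ler_sqr ?nnegrE ?qmod_ge0 ?addr_ge0 // qmod_sqr /qnsq /qdot -!expr2.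
rewrite -(real_normK (num_real (qre q))) -(real_normK (num_real (qi q))).
rewrite -(real_normK (num_real (qj q))) -(real_normK (num_real (qk q))).
have := (normr_ge0 (qre q), normr_ge0 (qi q), normr_ge0 (qj q), normr_ge0 (qk q)).
move=> [[[h0 h1] h2] h3].
by have := (mulr_ge0 h0 h1, mulr_ge0 h0 h2, mulr_ge0 h0 h3, mulr_ge0 h1 h2,
  mulr_ge0 h1 h3, mulr_ge0 h2 h3) => -[[[[[? ?] ?] ?] ?] ?]; nra.
Qed.

End QuatBasics.

(** Additive identities between quaternions are checked on the four real
    coordinates.  Products are best generalized beforehand, which keeps the
    polynomials small. *)
Ltac qring := apply: quatP; rewrite ?(qconjE, quatE); ring.

(** * Strictly differentiable and slice holomorphic functions *)

Section Strict.
Variable R : realType.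
Implicit Types (F G : R * R -> quat R) (u v w z h : R * R).
Implicit Types (a b c d p q J : quat R).

Definition qlin b c h : quat R := h.1 *: b + h.2 *: c.

(** Strict differentiability: both points of the increment move.  At all points
    of an open set it amounts to being C^1 there, so that no continuity of
    derivatives has to be carried along, and the estimates are automatically
    uniform on compact sets. *)
Definition sdiff F z b c := forall e : R, 0 < e ->
  \forall uv \near (z, z),
    qmod (F uv.1 - F uv.2 - qlin b c (uv.1 - uv.2)) <= e * `|uv.1 - uv.2|.

(** Left [J]-holomorphy at a point: the second partial derivative is [J] times
    the first, so that the differential is left multiplication of the slice
    increment, see [qlin_hol]. *)
Definition shol J F z := exists b, sdiff F z b (J * b).

Lemma qlin_hol J b h : qlin b (J * b) h = slice_pt J h * b.
Proof. by rewrite /qlin slice_ptE mulrDl -!scalerAl mul1r. Qed.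

Lemma norm_fst h : `|h.1| <= `|h|.
Proof. by rewrite prod_normE /= le_max lexx. Qed.

Lemma norm_snd h : `|h.2| <= `|h|.
Proof. by rewrite prod_normE /= le_max lexx orbT. Qed.

Lemma qmod_qlin b c h : qmod (qlin b c h) <= (qmod b + qmod c) * `|h|.
Proof.
apply: le_trans (qmodD _ _) _; rewrite !qmodZ mulrDl.
by rewrite lerD // mulrC ler_wpM2l ?qmod_ge0 ?norm_fst ?norm_snd.
Qed.

Lemma near_pair1 (P : R * R -> Prop) z :
  (\forall u \near z, P u) -> \forall uv \near (z, z), P uv.1.
Proof. by move=> h; apply: (@cvg_fst _ _ (nbhs z) (nbhs z)). Qed.

Lemma near_pair2 (P : R * R -> Prop) z :
  (\forall u \near z, P u) -> \forall uv \near (z, z), P uv.2.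
Proof. by move=> h; apply: (@cvg_snd _ _ (nbhs z) (nbhs z)). Qed.

Lemma cvg_pairT (T : Type) (X Y : topologicalType) (S : set_system T)
    (FS : Filter S) (f : T -> X) (g : T -> Y) (x : X) (y : Y) :
  f @ S --> x -> g @ S --> y -> (fun t => (f t, g t)) @ S --> (x, y).
Proof. by move=> fx gy; exact: (cvg_pair fx gy). Qed.

Lemma near_pair_l (P : (R * R) * (R * R) -> Prop) z :
  (\forall uv \near (z, z), P uv) -> \forall u \near z, P (u, z).
Proof.
move=> h; exact: (@cvg_pair _ _ _ (nbhs z) (nbhs z) (nbhs z) _ _ _ id
  (fun=> z) (@cvg_id _ _) (cvg_cst z) _ h).
Qed.

Lemma sdiff_scale k F z b c : 0 < k ->
  (forall e : R, 0 < e -> \forall uv \near (z, z),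
    qmod (F uv.1 - F uv.2 - qlin b c (uv.1 - uv.2)) <= k * e * `|uv.1 - uv.2|) ->
  sdiff F z b c.
Proof.
move=> k0 h e e0; have := h (k^-1 * e); rewrite mulVKf ?gt_eqF //; apply.
by rewrite mulr_gt0 ?invr_gt0.
Qed.

Lemma sdiff_ext F G z b c : (\forall u \near z, F u = G u) ->
  sdiff F z b c -> sdiff G z b c.
Proof.
move=> FG dF e e0; near=> uv.
have <- : F uv.1 = G uv.1 by near: uv; exact: (near_pair1 FG).
have <- : F uv.2 = G uv.2 by near: uv; exact: (near_pair2 FG).
by near: uv; exact: dF.
Unshelve. all: by end_near. Qed.

Lemma shol_ext J F G z : (\forall u \near z, F u = G u) ->
  shol J F z -> shol J G z.
Proof. by move=> FG [b db]; exists b; apply: sdiff_ext db. Qed.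

Lemma sdiff_lip F z b c : sdiff F z b c ->
  \forall uv \near (z, z),
    qmod (F uv.1 - F uv.2) <= (1 + (qmod b + qmod c)) * `|uv.1 - uv.2|.
Proof.
move=> /(_ 1 ltr01); apply: filterS => uv huv.
rewrite -[F uv.1 - _](subrK (qlin b c (uv.1 - uv.2))) mulrDl.
by apply: le_trans (qmodD _ _) (lerD huv (qmod_qlin _ _ _)).
Qed.

Lemma near_dist z (e : R) : 0 < e -> \forall u \near z, `|u - z| <= e.
Proof.
by move=> e0; apply: (@cvgr_distC_le _ _ _ _ _ id z (@cvg_id _ (nbhs z))).
Qed.

Lemma sdiff_near F z b c : sdiff F z b c -> forall e : R, 0 < e ->
  \forall u \near z, qmod (F u - F z) <= e.
Proof.
move=> /sdiff_lip /near_pair_l h e e0.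
set C := 1 + _ in h; have C0 : 0 < C by rewrite ltr_wpDr ?addr_ge0 ?qmod_ge0.
near=> u; apply: le_trans (_ : C * `|u - z| <= _).
  by near: u; apply: filterS h.
rewrite -ler_pdivlMl // mulrC; near: u; apply: near_dist.
by rewrite divr_gt0.
Unshelve. all: by end_near. Qed.

Lemma sdiff_cst a z : sdiff (fun=> a) z 0 0.
Proof.
move=> e e0; near=> uv.
by rewrite subrr /qlin !scaler0 addr0 subr0 qmod0 mulr_ge0 // ltW.
Unshelve. all: by end_near. Qed.

Lemma sdiff_slice J z : sdiff (slice_pt J) z 1 J.
Proof.
move=> e e0; near=> uv.
by rewrite -slice_ptB /qlin slice_ptE subrr qmod0 mulr_ge0 // ltW.
Unshelve. all: by end_near. Qed.

Lemma sdiffD F G z b c b' c' : sdiff F z b c -> sdiff G z b' c' ->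
  sdiff (fun u => F u + G u) z (b + b') (c + c').
Proof.
move=> dF dG; apply: (@sdiff_scale 2) => // e e0.
apply: filterS2 (dF e e0) (dG e e0) => uv hF hG.
rewrite [2 * e]mulr_natl mulr2n [leRHS]mulrDl; apply: le_trans (lerD hF hG).
apply: le_trans (qmodD _ _).
by rewrite le_eqVlt; apply/orP; left; apply/eqP; congr qmod; rewrite /qlin; qring.
Qed.

Lemma sdiff_conj F z b c : sdiff F z b c ->
  sdiff (fun u => qconj (F u)) z (qconj b) (qconj c).
Proof.
move=> dF e e0; apply: filterS (dF e e0) => uv; congr (_ <= _).
by rewrite -[LHS]qmod_conj; congr qmod; rewrite /qlin; qring.
Qed.

Lemma sdiff_flip F z b c : sdiff F (z.1, - z.2) b c ->
  sdiff (fun u => F (u.1, - u.2)) z b (- c).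
Proof.
move=> dF e e0.
have cf (u : R * R) : (fun u : R * R => (u.1, - u.2)) @ u --> (u.1, - u.2).
  by apply: cvg_pairT; [exact: cvg_fst | apply: cvgN; exact: cvg_snd].
have c1 := cvg_comp _ _ (@cvg_fst _ _ (nbhs z) (nbhs z) _) (cf z).
have c2 := cvg_comp _ _ (@cvg_snd _ _ (nbhs z) (nbhs z) _) (cf z).
have hc := cvg_pairT (nbhs_filter (z, z)) (c1 (nbhs_filter z)) (c2 (nbhs_filter z)).
pose fl (u : R * R) : R * R := (u.1, - u.2).
have hd : \forall uv \near (z, z), qmod (F (fl uv.1) - F (fl uv.2) -
    qlin b c (fl uv.1 - fl uv.2)) <= e * `|fl uv.1 - fl uv.2| by exact: hc _ (dF e e0).
apply: filterS hd => -[[u1 u2] [v1 v2]] /=; rewrite /fl /=.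
have -> : `|((u1, - u2) : R * R) - (v1, - v2)| = `|((u1, u2) : R * R) - (v1, v2)|.
  by rewrite !prod_normE /= -opprD normrN.
congr (qmod _ <= _); rewrite /qlin /=; qring.
Qed.

(** The error is split so that in each summand one factor is small and the
    others are bounded:
    [Fu * (dG - L') + (Fu - Fz) * L' + (dF - L) * Gv + L * (Gv - Gz)]. *)
Lemma sdiffM F G z b c b' c' : sdiff F z b c -> sdiff G z b' c' ->
  sdiff (fun u => F u * G u) z (b * G z + F z * b') (c * G z + F z * c').
Proof.
move=> dF dG.
set B := qmod b + qmod c; set B' := qmod b' + qmod c'.
have B0 : 0 <= B by rewrite addr_ge0 ?qmod_ge0.
have B'0 : 0 <= B' by rewrite addr_ge0 ?qmod_ge0.
set f := qmod (F z); set g := qmod (G z).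
have f0 : 0 <= f by exact: qmod_ge0.
have g0 : 0 <= g by exact: qmod_ge0.
apply: (@sdiff_scale ((f + 1) + B' + (g + 1) + B)); first by lra.
move=> e e0; have m0 : 0 < Num.min e 1 by rewrite lt_min e0 ltr01.
near=> uv.
have h1 : qmod (F uv.1 - F uv.2 - qlin b c (uv.1 - uv.2)) <= e * `|uv.1 - uv.2|.
  by near: uv; exact: dF.
have h2 : qmod (G uv.1 - G uv.2 - qlin b' c' (uv.1 - uv.2)) <= e * `|uv.1 - uv.2|.
  by near: uv; exact: dG.
have h3 : qmod (F uv.1 - F z) <= Num.min e 1.
  by near: uv; exact: (near_pair1 (sdiff_near dF m0)).
have h4 : qmod (G uv.2 - G z) <= Num.min e 1.
  by near: uv; exact: (near_pair2 (sdiff_near dG m0)).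
set h := uv.1 - uv.2 in h1 h2 *.
have [h3a h3b] : qmod (F uv.1 - F z) <= e /\ qmod (F uv.1) <= f + 1.
  move: h3; rewrite le_min => /andP[h3 h3']; split=> //.
  by rewrite -[F _](subrK (F z)) addrC (le_trans (qmodD _ _)) // lerD2l.
have [h4a h4b] : qmod (G uv.2 - G z) <= e /\ qmod (G uv.2) <= g + 1.
  move: h4; rewrite le_min => /andP[h4 h4']; split=> //.
  by rewrite -[G _](subrK (G z)) addrC (le_trans (qmodD _ _)) // lerD2l.
have -> : F uv.1 * G uv.1 - F uv.2 * G uv.2 -
    qlin (b * G z + F z * b') (c * G z + F z * c') h =
  F uv.1 * (G uv.1 - G uv.2 - qlin b' c' h) + (F uv.1 - F z) * qlin b' c' h
  + (F uv.1 - F uv.2 - qlin b c h) * G uv.2 + qlin b c h * (G uv.2 - G z).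
  have -> : qlin (b * G z + F z * b') (c * G z + F z * c') h =
      qlin b c h * G z + F z * qlin b' c' h.
    rewrite /qlin !mulrDl !mulrDr -!scalerAl -!scalerAr.
    by rewrite !scalerDr addrACA.
  rewrite !mulrBl !mulrBr; move: (F uv.1 * G uv.1) (F uv.2 * G uv.2).
  move: (F uv.1 * G uv.2) (F z * qlin b' c' h) (F uv.1 * qlin b' c' h).
  move: (qlin b c h * G uv.2) (qlin b c h * G z) => *; qring.
have -> : (f + 1 + B' + (g + 1) + B) * e * `|h| =
  (f + 1) * (e * `|h|) + e * (B' * `|h|) + e * `|h| * (g + 1) + B * `|h| * e.
  by ring.
apply: le_trans (qmodD _ _) _; apply: lerD; last first.
  by rewrite qmodM; apply: ler_pM; rewrite ?qmod_ge0 // qmod_qlin.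
apply: le_trans (qmodD _ _) _; apply: lerD; last first.
  by rewrite qmodM; apply: ler_pM; rewrite ?qmod_ge0.
apply: le_trans (qmodD _ _) _; apply: lerD.
  by rewrite qmodM; apply: ler_pM; rewrite ?qmod_ge0.
by rewrite qmodM; apply: ler_pM; rewrite ?qmod_ge0 // qmod_qlin.
Unshelve. all: by end_near. Qed.

Lemma qinvB p q : p != 0 -> q != 0 ->
  qinv p - qinv q = qinv p * (q - p) * qinv q.
Proof.
move=> p0 q0; rewrite mulrBr mulrBl qmulVl // mul1r.
by rewrite -mulrA qmulV // mulr1.
Qed.

(** Starts from [W u - W v = - W u * (F u - F v) * W v] with [W = qinv \o F], and
    then moves both outer factors to their values at [z]. *)
Lemma sdiffV F z b c : F z != 0 -> sdiff F z b c ->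
  sdiff (fun u => qinv (F u)) z (- (qinv (F z) * b * qinv (F z)))
    (- (qinv (F z) * c * qinv (F z))).
Proof.
move=> Fz0 dF; set B := qmod b + qmod c.
have B0 : 0 <= B by rewrite addr_ge0 ?qmod_ge0.
set m := (qmod (F z) / 2)^-1.
have n0 : 0 < qmod (F z) by rewrite qmod_gt0.
have m0 : 0 < m by rewrite invr_gt0 divr_gt0.
have near_bnd : \forall u \near z, F u != 0 /\ qmod (qinv (F u)) <= m.
  have n2 : 0 < qmod (F z) / 2 by rewrite divr_gt0.
  apply: filterS (sdiff_near dF n2) => u hu.
  have : qmod (F z) <= qmod (F u) + qmod (F u - F z).
    by rewrite -[X in qmod X <= _](subKr (F u) (F z)) qmodB_le.
  have n3 : qmod (F z) = qmod (F z) / 2 + qmod (F z) / 2 by rewrite -splitr.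
  move=> hu'; have hu2 : qmod (F z) / 2 <= qmod (F u) by lra.
  split; first by rewrite -qmod_gt0 (lt_le_trans n2).
  by rewrite qmod_inv /m lef_pV2 // posrE (lt_le_trans n2).
have [_ mz] := nbhs_singleton near_bnd.
apply: (@sdiff_scale (m * m + m * m * B * m + m * (B * (m * m)))).
  have m0' := ltW m0; apply: ltr_wpDr; first by rewrite !mulr_ge0.
  by apply: ltr_wpDr; rewrite ?mulr_gt0 ?mulr_ge0.
move=> e e0; near=> uv.
have h1 : qmod (F uv.1 - F uv.2 - qlin b c (uv.1 - uv.2)) <= e * `|uv.1 - uv.2|.
  by near: uv; exact: dF.
have h2 : qmod (F uv.1 - F z) <= e by near: uv; exact: (near_pair1 (sdiff_near dF e0)).
have h3 : qmod (F uv.2 - F z) <= e by near: uv; exact: (near_pair2 (sdiff_near dF e0)).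
have [u0 mu] : F uv.1 != 0 /\ qmod (qinv (F uv.1)) <= m.
  by near: uv; exact: (near_pair1 near_bnd).
have [v0 mv] : F uv.2 != 0 /\ qmod (qinv (F uv.2)) <= m.
  by near: uv; exact: (near_pair2 near_bnd).
set h := uv.1 - uv.2 in h1 *.
set Wu := qinv (F uv.1) in mu *; set Wv := qinv (F uv.2) in mv *.
set Wz := qinv (F z) in mz *.
have wu : qmod (Wu - Wz) <= m * m * e.
  rewrite /Wu /Wz qinvB // !qmodM [qmod (F z - _)]qmodBC mulrAC.
  by rewrite !ler_pM ?mulr_ge0 ?qmod_ge0.
have wv : qmod (Wv - Wz) <= m * m * e.
  rewrite /Wv /Wz qinvB // !qmodM [qmod (F z - _)]qmodBC mulrAC.
  by rewrite !ler_pM ?mulr_ge0 ?qmod_ge0.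
have -> : Wu - Wv - qlin (- (Wz * b * Wz)) (- (Wz * c * Wz)) h =
   - (Wu * (F uv.1 - F uv.2 - qlin b c h) * Wv + (Wu - Wz) * qlin b c h * Wv
      + Wz * (qlin b c h * (Wv - Wz))).
  have -> : qlin (- (Wz * b * Wz)) (- (Wz * c * Wz)) h = - (Wz * qlin b c h * Wz).
    rewrite /qlin mulrDr mulrDl -!scalerAr -!scalerAl.
    by move: (Wz * b * Wz) (Wz * c * Wz) => *; qring.
  rewrite [Wu - Wv]qinvB // -/Wu -/Wv !mulrBl !mulrBr !mulrBl !mulrA.
  move: (Wu * F uv.1 * Wv) (Wu * F uv.2 * Wv) (Wu * qlin b c h * Wv).
  by move: (Wz * qlin b c h * Wv) (Wz * qlin b c h * Wz) => *; qring.
have -> : (m * m + m * m * B * m + m * (B * (m * m))) * e * `|h| =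
  m * (e * `|h|) * m + m * m * e * (B * `|h|) * m + m * (B * `|h| * (m * m * e)).
  by ring.
have hL := qmod_qlin b c h; have h0 := normr_ge0 h.
have eh : 0 <= e * `|h| by rewrite mulr_ge0 // ltW.
have Bh : 0 <= B * `|h| by rewrite mulr_ge0.
rewrite qmodN; apply: le_trans (qmodD _ _) _; apply: lerD.
  apply: le_trans (qmodD _ _) _; apply: lerD; rewrite !qmodM.
    by rewrite !ler_pM ?mulr_ge0 ?qmod_ge0.
  by rewrite !ler_pM ?mulr_ge0 ?qmod_ge0.
by rewrite !qmodM !ler_pM ?mulr_ge0 ?qmod_ge0.
Unshelve. all: by end_near. Qed.

Lemma shol_cst J a z : shol J (fun=> a) z.
Proof. by exists 0; rewrite mulr0; exact: sdiff_cst. Qed.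

Lemma shol_slice J z : shol J (slice_pt J) z.
Proof. by exists 1; rewrite mulr1; exact: sdiff_slice. Qed.

Lemma sholD J F G z : shol J F z -> shol J G z -> shol J (fun u => F u + G u) z.
Proof.
by move=> [b db] [b' db']; exists (b + b'); rewrite mulrDr; exact: sdiffD.
Qed.

(** The complex structure acts by left multiplication, so it has to be moved past
    the left factor. *)
Lemma sholM J F G z : GRing.comm (F z) J -> shol J F z -> shol J G z ->
  shol J (fun u => F u * G u) z.
Proof.
move=> FJ [b db] [b' db']; exists (b * G z + F z * b').
by rewrite mulrDr !mulrA -FJ -(mulrA (F z)); exact: sdiffM.
Qed.

Lemma sholMr J F a z : shol J F z -> shol J (fun u => F u * a) z.
Proof.
move=> [b db]; exists (b * a).
have := sdiffM db (sdiff_cst a z); rewrite !mulr0 !addr0.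
by rewrite mulrA.
Qed.

Lemma sholN J F z : shol J F z -> shol J (fun u => - F u) z.
Proof.
by move=> /(@sholMr _ _ (-1)); apply: shol_ext; near=> u; rewrite mulrN1.
Unshelve. all: by end_near. Qed.

Lemma sholB J F G z : shol J F z -> shol J G z -> shol J (fun u => F u - G u) z.
Proof. by move=> dF dG; apply: sholD dF (sholN dG). Qed.

Lemma qinv_comm p J : p != 0 -> GRing.comm p J -> GRing.comm (qinv p) J.
Proof.
move=> p0 pJ; rewrite /GRing.comm -[LHS]mulr1 -(qmulV p0) mulrA.
by rewrite -(mulrA (qinv p)) -pJ mulrA qmulVl // mul1r.
Qed.

Lemma sholV J F z : F z != 0 -> GRing.comm (F z) J -> shol J F z ->
  shol J (fun u => qinv (F u)) z.
Proof.
move=> Fz0 FJ [b db]; exists (- (qinv (F z) * b * qinv (F z))).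
rewrite mulrN !mulrA -(qinv_comm Fz0 FJ) -(mulrA (qinv _) J).
exact: sdiffV.
Qed.

Lemma slice_pt_comm J z : GRing.comm (slice_pt J z) J.
Proof.
by rewrite /GRing.comm slice_ptE mulrDl mulrDr -!scalerAl -!scalerAr mul1r mulr1.
Qed.

End Strict.

(** * From continuous partial derivatives to strict differentiability *)

Section C1.
Variable R : realType.

Lemma mean_value_ball (f d : R -> R) (x r a b : R) :
  (forall t, `|t - x| < r -> is_derive t 1 f (d t)) ->
  `|a - x| < r -> `|b - x| < r ->
  exists2 t, `|t - x| < r & f a - f b = d t * (a - b).
Proof.
move=> df; wlog ab : a b / b <= a => [hw|] ha hb.
  have [ba|/ltW ab] := leP b a; first exact: hw.
  have [t ht e] := hw _ _ ab hb ha; exists t => //.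
  by rewrite -opprB e -mulrN opprB.
have inb t : t \in `[b, a] -> `|t - x| < r.
  rewrite in_itv /= => /andP[bt ta]; move: ha hb.
  by rewrite !ltr_norml => /andP[? ?] /andP[? ?]; apply/andP; split; lra.
have [||t tab e] := @MVT_segment R f d b a ab.
- by move=> t tab; apply: df; apply: inb; apply: subset_itv_oo_cc tab.
- by apply: derivable_within_continuous => t /inb /df [].
- by exists t => //; exact: inb.
Qed.

Lemma derive_row (g : R * R -> R) (t y : R) : derivable g (t, y) (1, 0) ->
  is_derive t 1 (fun s => g (s, y)) ('D_(1, 0) g (t, y)).
Proof.
have E : (fun h : R => h^-1 *: (((fun s => g (s, y)) \o shift t) (h *: 1) - g (t, y)))
  = (fun h : R => h^-1 *: ((g \o shift (t, y)) (h *: (1, 0)) - g (t, y))).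
  by apply/funext => h /=; congr (_ *: (g (_, _) - _)); rewrite /= ?scaler0 ?add0r.
by move=> dg; split; rewrite /derivable /derive E.
Qed.

Lemma derive_col (g : R * R -> R) (t y : R) : derivable g (t, y) (0, 1) ->
  is_derive y 1 (fun s => g (t, s)) ('D_(0, 1) g (t, y)).
Proof.
have E : (fun h : R => h^-1 *: (((fun s => g (t, s)) \o shift y) (h *: 1) - g (t, y)))
  = (fun h : R => h^-1 *: ((g \o shift (t, y)) (h *: (0, 1)) - g (t, y))).
  by apply/funext => h /=; congr (_ *: (g (_, _) - _)); rewrite /= ?scaler0 ?add0r.
by move=> dg; split; rewrite /derivable /derive E.
Qed.

Lemma coord_near (f : R * R -> quat R) (z : R * R) (e : R) : {for z, continuous f} -> 0 < e ->
  \forall u \near z, forall i, `|f u ord0 i - f z ord0 i| <= e.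
Proof.
move=> cf e0; have FF : Filter (nbhs z) by exact: nbhs_filter.
apply: (@filter_forall _ _ (fun i u => `|f u ord0 i - f z ord0 i| <= e) (nbhs z)) => i.
have ci : (fun u => f u ord0 i) @ z --> f z ord0 i.
  exact: (cvg_comp _ _ cf (@coord_continuous R 1 4 ord0 i (f z))).
exact: (@cvgr_distC_le R R _ (nbhs z) FF (fun u => f u ord0 i) (f z ord0 i) ci e e0).
Qed.

Lemma qlin_coord (p q b c : quat R) h i : (p - q - qlin b c h) ord0 i =
  p ord0 i - q ord0 i - (h.1 * b ord0 i + h.2 * c ord0 i).
Proof. by rewrite /qlin !mxE. Qed.

(** The values [p], [q], [r] are taken at the ends and at the corner of a
    right-angled path; [u] and [w] are the partial derivatives that the mean
    value theorem produces on its two legs. *)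
Lemma increment_coord (p q r b c u w : quat R) (h : R * R) (e : R) i :
  `|u ord0 i - b ord0 i| <= e -> `|w ord0 i - c ord0 i| <= e ->
  p ord0 i - q ord0 i = u ord0 i * h.1 -> q ord0 i - r ord0 i = w ord0 i * h.2 ->
  `|(p - r - qlin b c h) ord0 i| <= 2 * e * `|h|.
Proof.
move=> hu hw pq qr; have -> : (p - r - qlin b c h) ord0 i =
    (u ord0 i - b ord0 i) * h.1 + (w ord0 i - c ord0 i) * h.2.
  by rewrite qlin_coord !mulrBl -pq -qr; ring.
apply: le_trans (ler_normD _ _) _; rewrite !normrM mulr_natl mulr2n mulrDl.
by apply: lerD; apply: ler_pM; rewrite ?norm_fst ?norm_snd.
Qed.

(** The segment joining two points near [z] is replaced by a horizontal and a
    vertical one; on each the mean value theorem brings in a partial derivative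
    at a point close to [z], where it is close to its value at [z]. *)
Lemma C1_sdiff (U : set (R * R)) (g : R * R -> quat R) (z : R * R) :
  open U -> U z -> C1_on U g -> sdiff g z (dx g z) (dy g z).
Proof.
move=> oU Uz gC1; apply: (@sdiff_scale _ 8) => // e e0.
have [_ _ cx cy] := gC1 z Uz.
have nU : \forall u \near z, U u by exact: (open_nbhs_nbhs (conj oU Uz)).
have nx := coord_near cx e0; have ny := coord_near cy e0.
have /nbhs_normP[r /= r0 hr] : \forall u \near z, [/\ U u,
    forall i, `|dx g u ord0 i - dx g z ord0 i| <= e &
    forall i, `|dy g u ord0 i - dy g z ord0 i| <= e].
  by apply: filterS3 nU nx ny => u; split.
have near_r : \forall u \near z, `|u.1 - z.1| < r /\ `|u.2 - z.2| < r.
  apply/nbhs_normP; exists r => //= u; rewrite /= distrC => hu.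
  by split; apply: le_lt_trans hu; [exact: (norm_fst (u - z)) | exact: (norm_snd (u - z))].
have inr (t s : R) : `|t - z.1| < r -> `|s - z.2| < r -> [/\ U (t, s),
    forall i, `|dx g (t, s) ord0 i - dx g z ord0 i| <= e &
    forall i, `|dy g (t, s) ord0 i - dy g z ord0 i| <= e].
  move=> ht hs; apply: hr => /=.
  by rewrite distrC prod_normE /= gt_max ht hs.
apply: filterS2 (near_pair1 near_r) (near_pair2 near_r) => -[[a b] [a' b']] /=.
move=> [u1 u2] [v1 v2].
set h := (a, b) - (a', b').
have bound i : `|(g (a, b) - g (a', b') - qlin (dx g z) (dy g z) h) ord0 i|
    <= 2 * e * `|h|.
  have px t s : U (t, s) -> derivable (fun w => g w ord0 i) (t, s) (1, 0) /\
      'D_(1, 0) (fun w => g w ord0 i) (t, s) = dx g (t, s) ord0 i.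
    move=> /gC1[dg _ _ _]; split; first exact: (derivable_mxP _ _ _).1 dg ord0 i.
    by rewrite /dx (derive_mx dg) mxE.
  have py t s : U (t, s) -> derivable (fun w => g w ord0 i) (t, s) (0, 1) /\
      'D_(0, 1) (fun w => g w ord0 i) (t, s) = dy g (t, s) ord0 i.
    move=> /gC1[_ dg _ _]; split; first exact: (derivable_mxP _ _ _).1 dg ord0 i.
    by rewrite /dy (derive_mx dg) mxE.
  have [|t ht et] := @mean_value_ball (fun t => g (t, b) ord0 i)
    (fun t => dx g (t, b) ord0 i) z.1 r a a' _ u1 v1.
    move=> t ht; have [Ut _ _] := inr _ _ ht u2; have [dt <-] := px _ _ Ut.
    exact: (derive_row dt).
  have [|s hs es] := @mean_value_ball (fun s => g (a', s) ord0 i)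
    (fun s => dy g (a', s) ord0 i) z.2 r b b' _ u2 v2.
    move=> s hs; have [Us _ _] := inr _ _ v1 hs; have [ds <-] := py _ _ Us.
    exact: (derive_col ds).
  have [_ /(_ i) hx _] := inr _ _ ht u2; have [_ _ /(_ i) hy] := inr _ _ v1 hs.
  have {}et : g (a, b) ord0 i - g (a', b) ord0 i = dx g (t, b) ord0 i * (a - a').
    exact: et.
  have {}es : g (a', b) ord0 i - g (a', b') ord0 i = dy g (a', s) ord0 i * (b - b').
    exact: es.
  exact: (@increment_coord (g (a, b)) (g (a', b)) (g (a', b')) (dx g z) (dy g z)
    (dx g (t, b)) (dy g (a', s)) h e i hx hy et es).
apply: le_trans (qmod_le_sum _) _.
have := (bound (@Ordinal 4 0 isT), bound (@Ordinal 4 1 isT),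
  bound (@Ordinal 4 2 isT), bound (@Ordinal 4 3 isT)).
rewrite -/(qre _) -/(qi _) -/(qj _) -/(qk _) => -[[[h0 h1] h2] h3].
lra.
Unshelve. all: by end_near. Qed.

Lemma C1_shol (J : quat R) (U : set (R * R)) (g : R * R -> quat R) (z : R * R) :
  imag_units J -> open U -> U z -> C1_on U g ->
  (2^-1 : R) *: (dx g z + J * dy g z) = 0 -> shol J g z.
Proof.
move=> Ju oU Uz gC1 CR; exists (dx g z).
suff -> : J * dx g z = dy g z by exact: C1_sdiff gC1.
have {}CR : dx g z + J * dy g z = 0.
  by apply/eqP; move/eqP: CR; rewrite scaler_eq0 invr_eq0 pnatr_eq0.
move: (congr1 (fun q => J * q) CR) => /eqP.
by rewrite mulrDr mulrA (imag_unit_mul Ju) mulN1r mulr0 subr_eq0 => /eqP.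
Qed.

End C1.

(** * Mean values over regular polygons *)

Section RootsOfUnity.
Variable R : realType.
Implicit Types (z w u : R * R) (t e x : R).

Lemma norm_slice (J : quat R) z : imag_units J -> `|z| <= qmod (slice_pt J z).
Proof.
move=> Ju; rewrite prod_normE ge_max.
apply/andP; split; rewrite -ler_sqr ?nnegrE ?qmod_ge0 //;
  by rewrite qmod_sqr qnsq_slice // real_normK ?num_real // ?lerDl ?lerDr sqr_ge0.
Qed.

Lemma slice_le (J : quat R) z : imag_units J -> qmod (slice_pt J z) <= 2 * `|z|.
Proof.
move=> Ju; apply: le_trans (qmodD _ _) _.
rewrite !qmodZ qmod1 (imag_unit_mod Ju) !mulr1 mulr_natl mulr2n.
by rewrite lerD ?norm_fst ?norm_snd.
Qed.

(** Near each point of [K] the derivative of that point works for all base points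
    nearby, so near-covering compactness makes the scale [d] uniform.  Hence
    [D] is the derivative at a point near [z], not necessarily at [z]. *)
Lemma shol_uniform (J : quat R) (h : R * R -> quat R) (K : set (R * R)) (e : R) :
  compact K -> (forall z, K z -> shol J h z) -> 0 < e ->
  exists2 d, 0 < d & forall z, K z -> exists D, forall w, `|w - z| < d ->
    qmod (h w - h z - slice_pt J (w - z) * D) <= e * `|w - z|.
Proof.
move=> /compact_near_coveringP cK hK e0.
pose P (d : R) z := exists D, forall w, `|w - z| < d ->
    qmod (h w - h z - slice_pt J (w - z) * D) <= e * `|w - z|.
have : \forall d \near 0^'+, K `<=` P d.
  apply: cK => z /hK[b db].
  have [[A B] /= [nA nB] AB] := db e e0.
  have : \forall u \near z, A u /\ B u by apply: filterI.
  move=> /nbhs_normP[r /= r0 hr].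
  have r2 : 0 < r / 2 by rewrite divr_gt0.
  exists (ball z (r / 2), [set d | d < r / 2]); first split => /=.
  - exact: nbhsx_ballx.
  - exact: nbhs_right_lt.
  move=> [u d] /= [hu hd]; exists b => w hw; rewrite -qlin_hol.
  move: hu; rewrite -ball_normE /= => hu.
  have ru : `|z - u| < r by apply: lt_le_trans hu _; rewrite ler_pdivrMr //; lra.
  have rw : `|z - w| < r.
    rewrite -(subrKA u) (le_lt_trans (ler_normD _ _)) // (splitr r) ltrD //.
    by rewrite distrC (lt_trans hw).
  by apply: (AB (w, u)); split; [exact: (hr _ rw).1 | exact: (hr _ ru).2].
move=> H; have [d [d0 hd]] : exists d, 0 < d /\ K `<=` P d.
  have : \forall d \near 0^'+, 0 < d /\ K `<=` P d.
    by near=> d; split; near: d; [exact: nbhs_right_gt | exact: H].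
  by move=> /filter_ex[d hd]; exists d.
by exists d.
Unshelve. all: by end_near. Qed.

Definition unit_arc (J : quat R) x := slice_pt J (cos x, sin x).

Lemma unit_arcD (J : quat R) x y : imag_units J ->
  unit_arc J (x + y) = unit_arc J x * unit_arc J y.
Proof. by move=> Ju; rewrite /unit_arc slice_ptM //= cosD sinD [sin x * _ + _]addrC. Qed.

Lemma qmod_unit_arc (J : quat R) x : imag_units J -> qmod (unit_arc J x) = 1.
Proof. by move=> Ju; rewrite qmodE qnsq_slice //= cos2Dsin2 sqrtr1. Qed.

Lemma abs_sin_le x : `|sin x| <= `|x|.
Proof.
wlog x0 : x / 0 <= x => [hw|].
  have [|/ltW x0] := leP 0 x; first exact: hw.
  by rewrite -normrN -sinN -[`|x|]normrN; apply: hw; rewrite oppr_ge0.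
have [|c _] := @MVT_segment R sin cos 0 x x0 (fun y _ => is_derive_sin y).
  by apply: continuous_subspaceT; exact: continuous_sin.
rewrite sin0 !subr0 => ->; rewrite normrM ler_piMl //.
by rewrite ler_norml cos_geN1 cos_le1.
Qed.

Lemma qnsq_chord (J : quat R) x : imag_units J ->
  qnsq (unit_arc J x - 1) = (2 * sin (x / 2)) ^+ 2.
Proof.
move=> Ju; have -> : unit_arc J x - 1 = slice_pt J ((cos x, sin x) - (1, 0)).
  by rewrite slice_ptB [slice_pt J (1, 0)]slice_ptE /= scale1r scale0r addr0.
rewrite qnsq_slice //= subr0.
have := cos2Dsin2 x; have := cos2Dsin2 (x / 2); have := cosD (x / 2) (x / 2).
rewrite -splitr; move: (cos x) (sin x) (cos (x / 2)) (sin (x / 2)) => a b c s -> h1 h2.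
have {}h1 : c * c - s * s = 1 - 2 * s ^+ 2 by move: h1; lra.
by move: h2; rewrite h1; lra.
Qed.

Lemma chord_le (J : quat R) x : imag_units J -> qmod (unit_arc J x - 1) <= `|x|.
Proof.
move=> Ju; rewrite -ler_sqr ?nnegrE ?qmod_ge0 // qmod_sqr qnsq_chord //.
rewrite real_normK ?num_real // -ler_sqrt ?sqr_ge0 // !sqrtr_sqr normrM.
have := abs_sin_le (x / 2); rewrite normrM [`|2^-1|]ger0_norm // [`|2|]ger0_norm //.
lra.
Qed.

End RootsOfUnity.

Section CircleMean.
Variable R : realType.
Variable J : quat R.
Hypothesis Ju : imag_units J.
Implicit Types (z w u : R * R) (t e x : R).
Local Notation E := (unit_arc J).

(** The point [z + t * exp (J * x) * u] of the slice plane, in real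
    coordinates. *)
Definition circ z u t x : R * R :=
  z + (t * (cos x * u.1 - sin x * u.2), t * (cos x * u.2 + sin x * u.1)).

Lemma slice_circ z u t x :
  slice_pt J (circ z u t x) = slice_pt J z + t *: (E x * slice_pt J u).
Proof.
by rewrite /unit_arc slice_ptM //= /circ !slice_ptE /=; qring.
Qed.

Lemma circ_dist z u t x t' x' :
  `|circ z u t' x' - circ z u t x| <=
    qmod (t' *: (E x' * slice_pt J u) - t *: (E x * slice_pt J u)).
Proof.
apply: le_trans (norm_slice _ Ju) _; rewrite slice_ptB !slice_circ.
by rewrite opprD addrACA subrr add0r.
Qed.

Lemma circ0 z u x : circ z u 0 x = z.
Proof. by rewrite /circ !mul0r addr0. Qed.

Lemma circ_periodic z u t : circ z u t (pi *+ 2) = circ z u t 0.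
Proof. by rewrite /circ cos2pi sin2pi cos0 sin0. Qed.

Section Step.
Variables (h : R * R -> quat R) (z0 u : R * R) (d e : R) (N : nat).
Let r := qmod (slice_pt J u).
Let a : R := pi *+ 2 / N%:R.
Let S t := \sum_(k < N) h (circ z0 u t (a * k%:R)).
Hypothesis e0 : 0 < e.
Hypothesis N1 : (1 < N)%N.
Hypothesis ar : a * r < d.
Hypothesis hd : forall z, `|z - z0| <= r -> exists D, forall w, `|w - z| < d ->
    qmod (h w - h z - slice_pt J (w - z) * D) <= e * `|w - z|.

Let N0 : 0 < N%:R :> R.
Proof. by rewrite ltr0n ltnW. Qed.

Let a0 : 0 < a.
Proof. by rewrite divr_gt0 // mulrn_wgt0 // pi_gt0. Qed.

Let s := qmod (E a - 1).

Let s0 : 0 < s.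
Proof.
rewrite qmod_gt0 -qnsq_eq0 qnsq_chord // sqrf_eq0 mulf_neq0 //.
rewrite gt_eqF // sin_gt0_pi // divr_gt0 //=.
rewrite /a mulrAC -(mulr_natr pi) mulfK // ltr_pdivrMr // ltr_pMr ?pi_gt0 //.
by rewrite ltr1n.
Qed.

Let qmodE_arc x : qmod (E x * slice_pt J u) = r.
Proof. by rewrite qmodM qmod_unit_arc // mul1r. Qed.

(** Write [D k] for the approximate derivative at the [k]th vertex, [E k] for the
    [k]th root of unity, and [V] for the sum of the [E k * U * D k].  Changing
    the radius by [t' - t] changes the sum of the values by [(t' - t) *: V] up to
    a small error.  Going once around the polygon, the values telescope to 0 while
    their increments sum up to [t *: ((E a - 1) * V)]; the errors made are
    proportional to the chord length [s = qmod (E a - 1)], which therefore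
    cancels and leaves [V] itself small.  This is the polar form of the
    Cauchy-Riemann equation, integrated over a circle. *)
Lemma circle_sum_step t t' : 0 < t -> t <= 1 -> `|t' - t| * r < d ->
  qmod (S t' - S t) <= 2 * N%:R * e * r * `|t' - t|.
Proof.
move=> t0 t1 tr.
have hK k : `|circ z0 u t (a * k%:R) - z0| <= r.
  rewrite -[X in _ - X](circ0 z0 u 0); apply: le_trans (circ_dist _ _ _ _ _ _) _.
  rewrite scale0r subr0 qmodZ qmodE_arc gtr0_norm //.
  by rewrite ler_piMl ?qmod_ge0.
have [D hD] := choice (fun k => hd (hK k)).
pose U := slice_pt J u.
pose c k := circ z0 u t (a * k%:R).
pose V := \sum_(k < N) E (a * k%:R) * U * D k.
have radial (k : nat) : qmod (h (circ z0 u t' (a * k%:R)) - h (c k)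
    - (t' - t) *: (E (a * k%:R) * U * D k)) <= e * (`|t' - t| * r).
  have le : `|circ z0 u t' (a * k%:R) - c k| <= `|t' - t| * r.
    apply: le_trans (circ_dist _ _ _ _ _ _) _.
    by rewrite -scalerBl qmodZ qmodE_arc.
  have := hD k _ (le_lt_trans le tr).
  rewrite slice_ptB !slice_circ opprD addrACA subrr add0r -scalerBl -(@scalerAl _ (quat R)).
  by move=> /le_trans; apply; rewrite ler_pM2l.
have angular (k : nat) : qmod (h (c k.+1) - h (c k)
    - t *: ((E a - 1) * (E (a * k%:R) * U * D k))) <= e * (t * s * r).
  have chord : t *: (E (a * k.+1%:R) * U) - t *: (E (a * k%:R) * U) =
      t *: ((E a - 1) * (E (a * k%:R) * U)).
    have -> : a * k.+1%:R = a + a * k%:R by rewrite -nat1r; ring.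
    rewrite unit_arcD // -(@mulrA (quat R)) -scalerBr; congr (_ *: _).
    by rewrite mulrBl mul1r.
  have le : `|c k.+1 - c k| <= t * s * r.
    apply: le_trans (circ_dist _ _ _ _ _ _) _.
    by rewrite chord qmodZ qmodM qmodE_arc gtr0_norm // mulrA.
  have lt : t * s * r < d.
    apply: le_lt_trans ar; apply: ler_wpM2r; first exact: qmod_ge0.
    rewrite -[leRHS]mul1r; apply: ler_pM => //; [exact: ltW | exact: qmod_ge0 |].
    by rewrite -[leRHS]gtr0_norm //; exact: chord_le.
  have := hD k _ (le_lt_trans le lt).
  rewrite slice_ptB !slice_circ opprD addrACA subrr add0r chord -(@scalerAl _ (quat R)) -(@mulrA (quat R)).
  by move=> /le_trans; apply; rewrite ler_pM2l.
have V_le : qmod V <= N%:R * e * r.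
  have tel : \sum_(k < N) (h (c k.+1) - h (c k)) = 0.
    rewrite -(big_mkord xpredT (fun k => h (c k.+1) - h (c k))) telescope_sumr //.
    rewrite /c mulr0 /a divfK ?gt_eqF // circ_periodic subrr.
    by [].
  have : qmod (\sum_(k < N) (h (c k.+1) - h (c k)
    - t *: ((E a - 1) * (E (a * k%:R) * U * D k)))) <= N%:R * (e * (t * s * r)).
    apply: le_trans (qmod_sum _) _.
    apply: (@le_trans _ _ (\sum_(k < N) e * (t * s * r))).
      by apply: ler_sum => k _; exact: angular.
    by rewrite sumr_const card_ord mulr_natl.
  rewrite sumrB tel sub0r qmodN -scaler_sumr -mulr_sumr -/V qmodZ qmodM -/s.
  rewrite gtr0_norm // => le; rewrite -(ler_pM2l t0) -(ler_pM2l s0).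
  by rewrite mulrCA; apply: le_trans le _; rewrite le_eqVlt; apply/orP; left;
    apply/eqP; ring.
have -> : S t' - S t = \sum_(k < N) (h (circ z0 u t' (a * k%:R)) - h (c k)
    - (t' - t) *: (E (a * k%:R) * U * D k)) + (t' - t) *: V.
  by rewrite !sumrB -scaler_sumr -/V subrK.
apply: le_trans (qmodD _ _) _.
have -> : 2 * N%:R * e * r * `|t' - t| =
  N%:R * (e * (`|t' - t| * r)) + `|t' - t| * (N%:R * e * r) by ring.
apply: lerD; last by rewrite qmodZ ler_wpM2l.
apply: le_trans (qmod_sum _) _.
apply: (@le_trans _ _ (\sum_(k < N) e * (`|t' - t| * r))).
  by apply: ler_sum => k _; exact: radial.
by rewrite sumr_const card_ord mulr_natl.
Qed.

(** Discrete mean value property: the [N] steps of [circle_sum_step] from the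
    circle down to its centre add up. *)
Lemma circle_sum_le : qmod (S 1 - N%:R *: h z0) <= 2 * N%:R * e * r.
Proof.
have -> : N%:R *: h z0 = S 0.
  rewrite /S (eq_bigr (fun=> h z0)) => [|k _]; last by rewrite circ0.
  by rewrite sumr_const card_ord scaler_nat.
have -> : S 1 - S 0 = \sum_(j < N) (S (j.+1%:R / N%:R) - S (j%:R / N%:R)).
  rewrite -(big_mkord xpredT (fun j => S (j.+1%:R / N%:R) - S (j%:R / N%:R))).
  by rewrite telescope_sumr // divff ?gt_eqF // mul0r.
apply: le_trans (qmod_sum _) _.
have dist (j : 'I_N) : `|j%:R / N%:R - j.+1%:R / N%:R : R| = N%:R^-1.
  by rewrite distrC -mulrBl -nat1r addrK mul1r gtr0_norm // invr_gt0.
apply: le_trans (_ : \sum_(j < N) 2 * N%:R * e * r * N%:R^-1 <= _); last first.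
  by rewrite sumr_const card_ord -[leLHS]mulr_natr divfK ?gt_eqF.
apply: ler_sum => j _; rewrite qmodBC -{3}(dist j).
apply: circle_sum_step.
- by rewrite divr_gt0 // ltr0n.
- by rewrite ler_pdivrMr // mul1r ler_nat.
- rewrite dist; apply: le_lt_trans ar; apply: ler_wpM2r; first exact: qmod_ge0.
  rewrite /a -[leLHS]mul1r; apply: ler_wpM2r; first by rewrite invr_ge0 ltW.
  by have := pi_ge2 R; rewrite mulr2n; lra.
Qed.

End Step.
End CircleMean.

(** * Strong maximum modulus principle *)

Section StrongMax.
Variable R : realType.
Variable J : quat R.
Hypothesis Ju : imag_units J.
Implicit Types (z w u : R * R).

Definition box z (r : R) : set (R * R) :=
  `[z.1 - r, z.1 + r]%classic `*` `[z.2 - r, z.2 + r]%classic.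

Lemma boxP z r w : box z r w <-> `|w - z| <= r.
Proof.
rewrite /box prod_normE ge_max /= !in_itv /= !ler_distl; split.
  by case=> -> ->.
by move/andP.
Qed.

Lemma box_compact z r : compact (box z r).
Proof. by apply: compact_setX; exact: segment_compact. Qed.

Lemma near_box z (P : R * R -> Prop) : (\forall w \near z, P w) ->
  exists2 r : R, 0 < r & forall w, `|w - z| <= r -> P w.
Proof.
move=> /nbhs_normP[r /= r0 hr]; exists (r / 2); first by rewrite divr_gt0.
move=> w hw; apply: hr => /=; rewrite distrC; apply: le_lt_trans hw _.
by rewrite ltr_pdivrMr // ltr_pMr // ltr1n.
Qed.

Lemma ex_nat_div (x d : R) : 0 <= x -> 0 < d ->
  exists2 n, (1 < n)%N & x / n%:R < d.
Proof.
move=> x0 d0; exists (Num.bound (x / d)).+2 => //.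
rewrite ltr_pdivrMr ?ltr0n // -ltr_pdivrMl // mulrC.
apply: lt_trans (archi_boundP _) _; first by rewrite divr_ge0 // ltW.
by rewrite ltr_nat ltnW.
Qed.

Lemma qdot_suml (n : nat) (F : 'I_n -> quat R) q :
  qdot (\sum_i F i) q = \sum_i qdot (F i) q.
Proof.
apply: (big_morph (fun p => qdot p q)) => [p1 p2|].
  by rewrite /qdot !quatE; ring.
by rewrite /qdot !quatE; ring.
Qed.

(** Expanding the square, the sum is at most twice the inner product of [c] with
    [n%:R *: c - \sum_i F i]: values that do not exceed [c] in modulus and whose
    mean is close to [c] have little room to deviate from it. *)
Lemma variance_le (n : nat) (F : 'I_n -> quat R) c :
  (forall i, qmod (F i) <= qmod c) ->
  \sum_i qnsq (F i - c) <= 2 * (qmod (\sum_i F i - n%:R *: c) * qmod c).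
Proof.
move=> Fc; have -> : 2 * (qmod (\sum_i F i - n%:R *: c) * qmod c) =
    2 * (qmod (n%:R *: c - \sum_i F i) * qmod c) by rewrite qmodBC.
apply: (@le_trans _ _ (2 * qdot (n%:R *: c - \sum_i F i) c)); last first.
  by rewrite ler_pM2l // qdot_le.
have -> : 2 * qdot (n%:R *: c - \sum_i F i) c =
    \sum_(i < n) (2 * qnsq c - 2 * qdot (F i) c).
  rewrite sumrB sumr_const card_ord -mulr_sumr -qdot_suml.
  move: (\sum_i F i) => S; rewrite -mulr_natl /qnsq /qdot !quatE; ring.
apply: ler_sum => i _; rewrite qnsqB; have := Fc i; rewrite qmod_le; lra.
Qed.

(** The mean of [h] over the vertices of a regular polygon tends to [h z0], so by
    [variance_le] the mean of [qnsq (h - h z0)] tends to 0.  If [h] differed from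
    [h z0] at some point [z1] of the circle, it would do so on an arc, which
    carries a fixed fraction [1 / M] of the vertices. *)
Lemma strong_maximum (h : R * R -> quat R) z0 :
  (\forall z \near z0, shol J h z) ->
  (\forall z \near z0, qmod (h z) <= qmod (h z0)) ->
  \forall z \near z0, h z = h z0.
Proof.
move=> hh hm; have [p p0 hp] := near_box (filterI hh hm).
have p2 : 0 < p / 2 by rewrite divr_gt0.
apply: filterS (near_dist z0 p2) => z1 z1p.
pose u := z1 - z0; pose U := slice_pt J u; pose r := qmod U.
have rp : r <= p by apply: le_trans (slice_le _ Ju) _; rewrite -/u in z1p; lra.
have r0 : 0 <= r by exact: qmod_ge0.
apply/eqP/negPn/negP => neq.
pose dd := qmod (h z1 - h z0); pose H := qmod (h z0).
have H0 : 0 <= H by exact: qmod_ge0.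
have dd0 : 0 < dd by rewrite qmod_gt0 subr_eq0.
have dd2 : 0 < dd / 2 by rewrite divr_gt0.
have [b sb] : shol J h z1 by apply: (hp _ _).1; lra.
have [d1 d10 hd1] := near_box (sdiff_near sb dd2).
have pi20 : 0 <= pi *+ 2 * r by rewrite mulr_ge0 // mulrn_wge0 // pi_ge0.
have [M M1 hM] := ex_nat_div pi20 d10.
have M0 : 0 < M%:R :> R by rewrite ltr0n ltnW.
(* Makes [4 * M%:R * e * r * H] smaller than [dd ^+ 2 / 4].  Multiplied by the
   number [q] of vertices on the arc, these are the upper bound for the sum of the
   squared deviations and the contribution of the arc to it. *)
pose e := dd ^+ 2 / (16 * M%:R * (H * r + 1)).
have den0 : 0 < 16 * M%:R * (H * r + 1).
  by rewrite !mulr_gt0 // ltr_wpDl // mulr_ge0.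
have e0 : 0 < e by rewrite divr_gt0 // exprn_gt0.
have [d d0 hd] := shol_uniform (@box_compact z0 p)
  (fun z hz => (hp z ((boxP _ _ _).1 hz)).1) e0.
have [q q1 hq] := ex_nat_div pi20 d0.
have q0 : 0 < q%:R :> R by rewrite ltr0n ltnW.
(* With [M * q] vertices, the first [q] of them lie on the arc near [z1]. *)
pose N := (M * q)%N; pose a : R := pi *+ 2 / N%:R.
have N1 : (1 < N)%N by apply: leq_trans M1 _; rewrite leq_pmulr // ltnW.
have NE : N%:R = M%:R * q%:R :> R by rewrite natrM.
have aE : a = pi *+ 2 / (M%:R * q%:R) by rewrite -NE.
have a0 : 0 <= a by rewrite divr_ge0 // mulrn_wge0 // pi_ge0.
have ar : a * r < d.
  apply: le_lt_trans hq; rewrite mulrAC ler_wpM2l // lef_pV2 ?posrE ?ltr0n //.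
    by rewrite ler_nat leq_pmull // ltnW.
  by rewrite ltnW.
  by rewrite ltnW.
have hz z : `|z - z0| <= r -> exists D, forall w, `|w - z| < d ->
    qmod (h w - h z - slice_pt J (w - z) * D) <= e * `|w - z|.
  by move=> hz; apply: hd; apply/boxP; apply: le_trans rp.
have sum_le := circle_sum_le Ju e0 N1 ar hz.
pose c (k : nat) := circ z0 u 1 (a * k%:R).
have cz k : `|c k - z0| <= p.
  rewrite -[X in _ - X](circ0 z0 u 0); apply: le_trans (circ_dist Ju _ _ _ _ _ _) _.
  by rewrite scale0r subr0 scale1r qmodM qmod_unit_arc // mul1r.
have var := @variance_le N (fun k => h (c k)) (h z0) (fun k => (hp _ (cz k)).2).
have near1 k : (k <= q)%N -> dd ^+ 2 / 4 <= qnsq (h (c k) - h z0).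
  move=> kq; have le : `|c k - z1| <= d1.
    have -> : z1 = circ z0 u 1 0.
      rewrite /circ cos0 sin0 !mul1r !mul0r subr0 addr0 /u.
      by rewrite -[LHS](subrK z0) addrC; congr (_ + _); case: (z1 - z0).
    apply: le_trans (circ_dist Ju _ _ _ _ _ _) _.
    have -> : unit_arc J 0 = 1.
      by rewrite /unit_arc cos0 sin0 slice_ptE scale0r scale1r addr0.
    rewrite !scale1r mul1r -[X in _ - X]mul1r -mulrBl qmodM -/r.
    apply: le_trans (ltW hM).
    have -> : pi *+ 2 * r / M%:R = pi *+ 2 / M%:R * r by rewrite mulrAC.
    apply: ler_wpM2r => //.
    apply: le_trans (chord_le _ Ju) _.
    rewrite ger0_norm; last by apply: mulr_ge0.
    have -> : a * k%:R = pi *+ 2 / M%:R * (q%:R^-1 * k%:R) by rewrite aE invfM !mulrA.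
    apply: ler_piMr.
      by apply: divr_ge0; [rewrite mulrn_wge0 // pi_ge0 | exact: ltW].
    by rewrite ler_pdivrMl // mulr1 ler_nat.
  have := hd1 _ le; have : dd <= qmod (h (c k) - h z0) + qmod (h (c k) - h z1).
    rewrite /dd; have -> : h z1 - h z0 = (h (c k) - h z0) - (h (c k) - h z1).
      by rewrite opprB [RHS]addrC subrKA.
    exact: qmodB_le.
  move=> A B; have C : dd / 2 <= qmod (h (c k) - h z0) by lra.
  rewrite -qmod_sqr; have -> : dd ^+ 2 / 4 = (dd / 2) ^+ 2 by field.
  by rewrite ler_sqr ?nnegrE ?qmod_ge0 // ltW.
have low : q%:R * (dd ^+ 2 / 4) <= \sum_(k < N) qnsq (h (c k) - h z0).
  have qN : (q <= N)%N by rewrite leq_pmull // ltnW.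
  have -> : q%:R * (dd ^+ 2 / 4) = \sum_(k < q) (dd ^+ 2 / 4).
    by rewrite sumr_const card_ord mulr_natl.
  rewrite (big_ord_widen _ (fun=> dd ^+ 2 / 4) qN) big_mkcond /=.
  apply: ler_sum => k _; case: ifP => kq; last exact: qnsq_ge0.
  by apply: near1; exact: ltnW.
have : q%:R * (dd ^+ 2 / 4) <= 2 * (2 * N%:R * e * r * H).
  apply: le_trans low _; apply: le_trans var _.
  rewrite ler_pM2l //; apply: ler_wpM2r => //; exact: sum_le.
have -> : 2 * (2 * N%:R * e * r * H) = q%:R * (4 * M%:R * e * r * H).
  by rewrite NE; ring.
rewrite ler_pM2l //; apply/negP; rewrite -ltNge.
have edd : e * (16 * M%:R * (H * r + 1)) = dd ^+ 2 by rewrite divfK ?gt_eqF.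
have eM : 0 < e * M%:R by rewrite mulr_gt0.
rewrite -edd; lra.
Qed.

End StrongMax.

(** * Identity principle *)

Section Identity.
Variable R : realType.
Implicit Types (z w u c : R * R) (K F D : set (R * R)).

(** At this maximizer [m] cannot be constant on a neighbourhood contained in
    [K], for it could be moved to the right. *)
Lemma extremal_maximizer (m : R * R -> R) K : K !=set0 -> compact K ->
  (forall z, K z -> m @ z --> m z) ->
  exists z, [/\ K z, forall w, K w -> m w <= m z &
    forall w, K w -> m z <= m w -> w.1 <= z.1].
Proof.
move=> K0 cK mK.
have [|z0 /set_mem Kz0 hz0] := compact_EVT_max K0 cK (f := m).
  by apply: continuous_in_subspaceT => z /set_mem /mK.
have Kcl : closed K by apply: compact_closed cK; exact: norm_hausdorff.
pose T := [set z | K z /\ m z0 <= m z].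
have Tcl : closed T.
  move=> z Tz; have Kz : K z by apply: Kcl => B /Tz[w [[Kw _] Bw]]; exists w.
  split=> //; rewrite leNgt; apply/negP => lt.
  have /Tz[w [[_ le] gt]] : nbhs z [set w | m w < m z0].
    exact: (@cvgr_lt R (R * R)%type (nbhs z) _ m (m z) (mK z Kz) _ lt).
  by move: le; rewrite leNgt gt.
have cT : compact T by apply: subclosed_compact Tcl cK _ => z [].
have T0 : T !=set0 by exists z0.
have [|z /set_mem[Kz mz] hz] := @compact_EVT_max _ R (fun w : R * R => w.1) T T0 cT.
  by apply: continuous_subspaceT => z; exact: cvg_fst.
exists z; split=> // w Kw; first by apply: le_trans mz; apply: hz0; apply: mem_set.
by move=> le; apply: hz; apply: mem_set; split=> //; apply: le_trans le.
Qed.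

Variable J : quat R.
Hypothesis Ju : imag_units J.

Lemma shol_qmod_continuous (g : R * R -> quat R) z : shol J g z ->
  (fun u => qmod (g u)) @ z --> qmod (g z).
Proof.
move=> [b sb]; apply/cvgrPdist_le => e e0.
apply: filterS (sdiff_near sb e0) => u; apply: le_trans.
rewrite ler_norml lerNl opprB -[X in X <= _]addr0.
have h1 := qmodD (g u - g z) (g z); have h2 := qmodB_le (g u) (g u - g z).
by rewrite subrK in h1; rewrite subKr in h2; apply/andP; split; lra.
Qed.

Definition plane_dist c z : R := qmod (slice_pt J (z - c)).

Lemma shol_shift c z : shol J (fun u => slice_pt J (u - c)) z.
Proof.
have := sholB (shol_slice J z) (shol_cst J (slice_pt J c) z).
by apply: shol_ext; near=> u; rewrite slice_ptB.
Unshelve. all: by end_near. Qed.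

Lemma dist_continuous c : continuous (plane_dist c).
Proof. by move=> z; apply: (shol_qmod_continuous (shol_shift c z)). Qed.

Lemma slice_pt_eq0 z : slice_pt J z = 0 -> z = 0.
Proof.
move/(congr1 (@qmod R)); rewrite qmod0 => e.
by apply/eqP; rewrite -normr_le0 -e norm_slice.
Qed.

(** The quotient [(z - c) ^- n * g z], with [z - c] read in the slice plane. *)
Fixpoint polar_weight c (g : R * R -> quat R) n : R * R -> quat R :=
  if n is m.+1 then fun z => qinv (slice_pt J (z - c)) * polar_weight c g m z else g.

Lemma polar_weight_mod c g n z :
  qmod (polar_weight c g n z) = qmod (g z) / plane_dist c z ^+ n.
Proof.
elim: n => [|n IHn] /=; first by rewrite divr1.
by rewrite qmodM qmod_inv IHn -/(plane_dist c z) mulrCA -invfM exprS.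
Qed.

Lemma polar_weight_shol c g n z : z != c -> shol J g z ->
  shol J (polar_weight c g n) z.
Proof.
move=> zc gz; elim: n => [//|n IHn] /=.
have W0 : slice_pt J (z - c) != 0.
  by apply: contraNneq zc => /slice_pt_eq0/eqP; rewrite subr_eq0.
apply: (@sholM R J (fun u => qinv (slice_pt J (u - c))) _ z _ _ IHn).
  exact: qinv_comm W0 (slice_pt_comm _ _).
exact: (@sholV R J (fun u => slice_pt J (u - c)) z W0 (slice_pt_comm _ _)
  (shol_shift c z)).
Qed.

Lemma bernoulli_le (t : R) n : 0 <= t -> 1 + n%:R * t <= (1 + t) ^+ n.
Proof.
move=> t0; elim: n => [|n IHn]; first by rewrite mul0r addr0 expr0.
rewrite exprS; apply: le_trans (ler_wpM2l _ IHn); last lra.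
have := mulr_ge0 (mulr_ge0 (ler0n R n) t0) t0; rewrite -natr1; lra.
Qed.

Lemma expr_unbounded (x y : R) : 1 < x -> exists n, y < x ^+ n.
Proof.
move=> x1; have t0 : 0 < x - 1 by rewrite subr_gt0.
pose n := Num.bound (`|y| / (x - 1)); exists n.
apply: lt_le_trans (_ : 1 + n%:R * (x - 1) <= _); last first.
  by rewrite -[in leRHS](subrKC 1 x) bernoulli_le // ltW.
have : `|y| / (x - 1) < n%:R by apply: archi_boundP; rewrite divr_ge0 // ltW.
by rewrite ltr_pdivrMr // => h; have := ler_norm y; lra.
Qed.

(** A Carleman-type argument.  On the compact set [K] cut out of [F] by the disc
    of radius [r] about [c], the function [g] vanishes on the boundary except on
    the circle.  Dividing by [(z - c) ^+ n] keeps it holomorphic, since [c] is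
    outside [F], and by the maximum principle the quotient is largest on the
    circle.  Hence [qmod (g z) <= M * (plane_dist c z / r) ^+ n] for all [n],
    where [M] bounds [qmod g] on [K]. *)
Lemma vanish_polar (g : R * R -> quat R) c (r : R) F :
  closed F -> ~ F c ->
  (forall z, F z -> plane_dist c z <= r -> shol J g z) ->
  (forall z, F z -> plane_dist c z < r -> g z = 0 \/ \forall w \near z, F w) ->
  forall z, F z -> plane_dist c z < r -> g z = 0.
Proof.
move=> Fcl Fc gh gF z1 Fz1 z1r; apply/eqP/negPn/negP => gz1.
have dist_gt0 z : F z -> 0 < plane_dist c z.
  move=> Fz; rewrite qmod_gt0; apply/eqP => /slice_pt_eq0/eqP.
  by rewrite subr_eq0 => /eqP zc; rewrite zc in Fz.
have neqc z : F z -> z != c by move=> Fz; apply/eqP => zc; rewrite zc in Fz.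
pose K := F `&` [set z | plane_dist c z <= r].
have Kz1 : K z1 by split=> //; exact: ltW.
have cK : compact K.
  apply: subclosed_compact (@box_compact R c r) _.
    apply: closedI => //.
    apply: (@preimage_closed _ R (plane_dist c) [set x | x <= r]) => [z _|].
      exact: dist_continuous.
    exact: closed_le.
  by move=> z [_ zr]; apply/boxP; apply: le_trans (norm_slice _ Ju) zr.
have K0 : K !=set0 by exists z1.
have Kg z : K z -> shol J g z by case; exact: gh.
have [z0 /set_mem Kz0 hM] := compact_EVT_max K0 cK (continuous_in_subspaceT
  (fun z hz => shol_qmod_continuous (Kg z (set_mem hz)))).
pose M := qmod (g z0).
have r0 : 0 < r by apply: le_lt_trans z1r; exact: qmod_ge0.
have gz1_gt0 : 0 < qmod (g z1) by rewrite qmod_gt0.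
have [n hn] : exists n, M / qmod (g z1) < (r / plane_dist c z1) ^+ n.
  by apply: expr_unbounded; rewrite ltr_pdivlMr ?dist_gt0 // mul1r.
pose h := polar_weight c g n.
have Kh z : K z -> shol J h z.
  by move=> Kz; apply: polar_weight_shol (Kg z Kz); apply: neqc; case: Kz.
have [z [Kz zmax zext]] := extremal_maximizer K0 cK
  (fun z Kz => shol_qmod_continuous (Kh z Kz)).
have big : M / r ^+ n < qmod (h z).
  apply: lt_le_trans (zmax z1 Kz1); rewrite polar_weight_mod.
  rewrite expr_div_n ltr_pdivrMr // in hn; rewrite ltr_pdivrMr ?exprn_gt0 //.
  by rewrite mulrAC [_ * r ^+ n]mulrC mulrAC.
have [Fz zr] := Kz.
have {}zr : plane_dist c z < r.
  rewrite lt_neqAle zr andbT; apply/eqP => e; move: big.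
  rewrite polar_weight_mod e ltr_pM2r ?invr_gt0 ?exprn_gt0 //.
  by apply/negP; rewrite -leNgt; apply: hM; exact: mem_set.
have hz0 : 0 < qmod (h z).
  by apply: le_lt_trans big; rewrite divr_ge0 ?qmod_ge0 // exprn_ge0 // ltW.
have nF : \forall w \near z, F w.
  case: (gF z Fz zr) => // gz; move: hz0.
  by rewrite polar_weight_mod gz qmod0 mul0r ltxx.
have nr : \forall w \near z, plane_dist c w < r
  by exact: (@cvgr_lt R (R * R)%type (nbhs z) _ (plane_dist c) _ (@dist_continuous c z) _ zr).
have nK : \forall w \near z, K w by apply: filterS2 nF nr => w Fw /ltW.
have nh : \forall w \near z, shol J h w by apply: filterS nK.
have nm : \forall w \near z, qmod (h w) <= qmod (h z) by apply: filterS nK.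
have [d d0 hd] := near_box (filterI (strong_maximum Ju nh nm) nK).
have dz : `|(z + (d, 0)) - z| <= d.
  by rewrite addrC addKr prod_normE /= normr0 ge_max gtr0_norm // lexx ltW.
have [e Kd] := hd _ dz.
have := zext _ Kd; rewrite e lexx => /(_ isT); rewrite /= => le.
by move: d0; rewrite ltNge; move: le; rewrite gerDl => ->.
Qed.

Lemma dist_triangle a b c : plane_dist a c <= plane_dist a b + plane_dist b c.
Proof.
rewrite /plane_dist; have -> : slice_pt J (c - a) = slice_pt J (b - a) + slice_pt J (c - b).
  by rewrite !slice_ptB; qring.
exact: qmodD.
Qed.

Lemma dist_sym a b : plane_dist a b = plane_dist b a.
Proof. by rewrite /plane_dist !slice_ptB qmodBC. Qed.

Lemma near_dist_lt c z (r : R) : plane_dist c z < r -> \forall w \near z, plane_dist c w < r.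
Proof.
exact: (@cvgr_lt R (R * R)%type (nbhs z) _ (plane_dist c) _ (@dist_continuous c z) _).
Qed.

Lemma near_dist_gt c z (r : R) : r < plane_dist c z -> \forall w \near z, r < plane_dist c w.
Proof.
exact: (@cvgr_gt R (R * R)%type (nbhs z) _ (plane_dist c) _ (@dist_continuous c z) _).
Qed.

(** [vanish_polar] on an annulus whose inner circle lies where [g] vanishes. *)
Lemma vanish_disc (g : R * R -> quat R) c (r : R) :
  (forall z, plane_dist c z <= r -> shol J g z) -> (\forall z \near c, g z = 0) ->
  forall z, plane_dist c z < r -> g z = 0.
Proof.
move=> gh /near_box[s s0 hs] z zr.
have [zs|sz] := leP (plane_dist c z) s.
  by apply: hs; apply: le_trans zs; exact: norm_slice.
apply: (@vanish_polar g c r [set w | s <= plane_dist c w]) => //.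
- apply: (@preimage_closed _ R (plane_dist c) [set x | s <= x]) => [w _|].
    exact: dist_continuous.
  exact: closed_ge.
- rewrite /= /plane_dist subrr slice_ptE /= !scale0r addr0 qmod0.
  by apply/negP; rewrite -ltNge.
- by move=> w _; exact: gh.
- move=> w /= sw _; have [ws|{}sw] := leP (plane_dist c w) s.
    by left; apply: hs; apply: le_trans ws; exact: norm_slice.
  by right; apply: filterS (near_dist_gt sw) => u /ltW.
- exact: ltW.
Qed.

(** The interior of the zero set is closed in [D]: a limit point [z1] is within
    [r / 4] of a point [z2] near which [g] vanishes, and the disc of radius
    [r / 2] about [z2], which is still inside [D], reaches [z1]. *)
Theorem identity_principle (g : R * R -> quat R) D z0 : open D -> connected D ->
  (forall z, D z -> shol J g z) -> D z0 -> (\forall z \near z0, g z = 0) ->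
  forall z, D z -> g z = 0.
Proof.
move=> oD cD gD Dz0 gz0; pose A := D `&` [set z | \forall w \near z, g w = 0].
suff -> : D = A by move=> z [_]; exact: nbhs_singleton.
apply/esym; apply: cD; first by exists z0.
  exists [set z | \forall w \near z, g w = 0] => //.
  by rewrite openE => z /=; exact: near_join.
exists (closure A); first exact: closed_closure.
apply/seteqP; split=> [z Az|z1 [Dz1 clA]].
  by split; [case: Az | exact: subset_closure].
split=> //.
have [r r0 hr] := near_box (open_nbhs_nbhs (conj oD Dz1)).
have r4 : 0 < r / 4 by rewrite divr_gt0.
have d0 : plane_dist z1 z1 < r / 4 by rewrite /plane_dist subrr slice_ptE /= !scale0r addr0 qmod0.
have [z2 [[Dz2 gz2] z12]] := clA _ (near_dist_lt d0).
have vanish := @vanish_disc g z2 (r / 2) _ gz2.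
have z21 : plane_dist z2 z1 < r / 2 by rewrite dist_sym; move: z12 => /=; lra.
apply: filterS (near_dist_lt z21) => w; apply: vanish => z zr; apply: gD; apply: hr.
apply: le_trans (norm_slice _ Ju) _; rewrite -/(plane_dist z1 z).
by apply: le_trans (dist_triangle z1 z2 z) _; move: z12 => /=; lra.
Qed.

(** The sign [s] selects a side of the real axis.  A disc centred at distance 1
    from the axis on the opposite side, of radius [Num.sqrt (1 + t ^+ 2)], cuts out
    of the half plane a cap whose base has half-length [t]; [g] vanishes on the base
    and [vanish_polar] applies. *)
Lemma vanish_half (g : R * R -> quat R) (x0 s r : R) : s ^+ 2 = 1 -> 0 < r ->
  (forall z, `|z - (x0, 0)| <= r -> shol J g z) ->
  (forall x, `|x - x0| <= r -> g (x, 0) = 0) ->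
  \forall z \near ((x0, 0) : R * R), 0 <= s * z.2 -> g z = 0.
Proof.
move=> s1 r0 gh gx.
pose t := Num.min r 1.
have t0 : 0 < t by rewrite lt_min r0 ltr01.
have tr : t <= r by rewrite ge_min lexx.
have t1 : t <= 1 by rewrite ge_min lexx orbT.
pose rho := Num.sqrt (1 + t ^+ 2).
have t2 : 0 < t ^+ 2 by rewrite exprn_gt0.
have rho2 : rho ^+ 2 = 1 + t ^+ 2 by rewrite sqr_sqrtr //; lra.
have rho0 : 0 <= rho by exact: sqrtr_ge0.
pose c : R * R := (x0, - s).
have dist2 z : plane_dist c z ^+ 2 = (z.1 - x0) ^+ 2 + (z.2 + s) ^+ 2.
  by rewrite qmod_sqr qnsq_slice //= opprK.
have in_box z : 0 <= s * z.2 -> plane_dist c z <= rho -> `|z - (x0, 0)| <= t.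
  move=> sz; rewrite -ler_sqr ?nnegrE ?qmod_ge0 // dist2 rho2 => le.
  have h1 := sqr_ge0 (z.1 - x0); have h2 := sqr_ge0 z.2.
  have e : (z.2 + s) ^+ 2 = z.2 ^+ 2 + 2 * (s * z.2) + 1 by rewrite sqrrD s1; ring.
  rewrite e in le; have tt : t ^+ 2 <= t by rewrite expr2 ler_piMl // ltW.
  rewrite prod_normE ge_max /= subr0; apply/andP; split.
    rewrite -ler_sqr ?nnegrE ?(ltW t0) // real_normK ?num_real //; lra.
  rewrite -ler_sqr ?nnegrE ?(ltW t0) // real_normK ?num_real //; lra.
have scont : continuous (fun z : R * R => s * z.2).
  by move=> z; apply: cvgM; [exact: cvg_cst | exact: cvg_snd].
have x0c : plane_dist c (x0, 0) < rho.
  by rewrite -ltr_sqr ?nnegrE ?qmod_ge0 // dist2 rho2 /= subrr add0r expr0n add0r s1; lra.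
apply: filterS (near_dist_lt x0c) => z0 z0c s0.
apply: (@vanish_polar g c rho [set w | 0 <= s * w.2]) => //.
- apply: (@preimage_closed _ R (fun w : R * R => s * w.2) [set x | 0 <= x]) => [w _|].
    exact: scont.
  exact: closed_ge.
- by rewrite /= mulrN -expr2 s1; apply/negP; rewrite -ltNge; lra.
- by move=> w /= sw wr; apply: gh; apply: le_trans tr; exact: in_box.
- move=> w /= sw wr; move: (sw); rewrite le_eqVlt => /predU1P[e|pos].
    left; have w2 : w.2 = 0.
      by have := congr1 (fun x => s * x) e; rewrite mulr0 mulrA -expr2 s1 mul1r.
    have := in_box w sw (ltW wr); rewrite prod_normE ge_max /= => /andP[+ _].
    by move=> /le_trans/(_ tr)/gx; rewrite -w2; case: (w).
  right; have : \forall u \near w, 0 < s * u.2.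
    exact: (@cvgr_gt R (R * R)%type (nbhs w) _ (fun u => s * u.2) _ (scont w) _ pos).
  by apply: filterS => u /ltW.
Qed.

Lemma vanish_real (g : R * R -> quat R) (x0 r : R) : 0 < r ->
  (forall z, `|z - (x0, 0)| <= r -> shol J g z) ->
  (forall x, `|x - x0| <= r -> g (x, 0) = 0) ->
  \forall z \near ((x0, 0) : R * R), g z = 0.
Proof.
move=> r0 gh gx.
have up := @vanish_half g x0 1 r (expr1n _ _) r0 gh gx.
have N1 : (-1) ^+ 2 = 1 :> R by rewrite sqrrN expr1n.
have lo := @vanish_half g x0 (-1) r N1 r0 gh gx.
apply: filterS2 up lo => z; rewrite mul1r mulN1r oppr_ge0 => zu zl.
by have [/zu|/ltW/zl] := leP 0 z.2.
Qed.

End Identity.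

(** * Stem functions and the representation formula *)

Section Stem.
Variable R : realType.
Implicit Types (z w : R * R) (D : set (R * R)) (I J V a b c : quat R).

Lemma sdiffMl a (F : R * R -> quat R) z b c : sdiff F z b c ->
  sdiff (fun u => a * F u) z (a * b) (a * c).
Proof.
by move=> dF; have := sdiffM (sdiff_cst a z) dF; rewrite !mul0r !add0r.
Qed.

(** The Cauchy-Riemann equations of [B + i C] in the complexification of the
    quaternions, where [i] commutes with all quaternions.  Such a pair induces
    the slice function [B + J * C] for every imaginary unit [J] at once. *)
Definition stem_diff (B C : R * R -> quat R) z :=
  exists b c, sdiff B z b (- c) /\ sdiff C z c b.

Lemma stem_conj B C z : stem_diff B C z ->
  stem_diff (fun u => qconj (B u)) (fun u => qconj (C u)) z.
Proof.
move=> [b [c [dB dC]]]; exists (qconj b), (qconj c).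
by split; [rewrite -qconjN | ]; exact: sdiff_conj.
Qed.

Lemma stem_shol J B C z : imag_units J -> stem_diff B C z ->
  shol J (fun u => B u + J * C u) z.
Proof.
move=> Ju [b [c [dB dC]]]; exists (b + J * c).
rewrite mulrDr mulrA (imag_unit_mul Ju) mulN1r addrC.
rewrite [J * b - c]addrC.
by have := sdiffD dB (sdiffMl J dC); rewrite addrC.
Qed.

(** [stem_re] and [stem_im] solve [F z = B + I * C], [F (z.1, - z.2) = B - I * C]. *)
Definition stem_re I (F : R * R -> quat R) z : quat R :=
  (2^-1)%:A * (F z + F (z.1, - z.2)).
Definition stem_im I (F : R * R -> quat R) z : quat R :=
  (- (2^-1))%:A * (I * (F z - F (z.1, - z.2))).

Lemma stem_of_shol I F z : imag_units I -> shol I F z -> shol I F (z.1, - z.2) ->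
  stem_diff (stem_re I F) (stem_im I F) z.
Proof.
move=> Iu [d dF] [d' dF']; have dG := sdiff_flip dF'.
have dGN := sdiffMl (-1) dG.
exists ((2^-1)%:A * (d + d')), ((- (2^-1))%:A * (I * (d - d'))); split.
  have := sdiffMl (2^-1)%:A (sdiffD dF dG).
  by rewrite -mulrBr scaleNr mulNr opprK.
have := sdiffMl (- (2^-1))%:A (sdiffMl I (sdiffD dF dGN)).
rewrite mulrN !mulN1r opprK -mulrDr mulrA (mulrA I) (imag_unit_mul Iu).
rewrite mulN1r mulrN [in X in sdiff _ _ _ X]scaleNr mulNr opprK -mulrA.
by apply: sdiff_ext; near=> u; rewrite mulN1r.
Unshelve. all: by end_near. Qed.

Lemma slice_decomposition (q : quat R) :
  exists2 I, imag_units I & exists z, q = slice_pt I z.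
Proof.
pose n := qi q ^+ 2 + qj q ^+ 2 + qk q ^+ 2; pose y := Num.sqrt n.
have n0 : 0 <= n by rewrite !addr_ge0 ?sqr_ge0.
have [y0|y0] := eqVneq y 0.
  exists (mkquat 0 1 0 0).
    by apply/imag_unitP; rewrite /qnsq /qdot !mkquatE; split=> //; ring.
  exists (qre q, 0); move/eqP: y0; rewrite sqrtr_eq0 => nle.
  have : n == 0 by rewrite eq_le nle n0.
  rewrite !paddr_eq0 ?addr_ge0 ?sqr_ge0 // !sqrf_eq0.
  move=> /andP[/andP[/eqP qi0 /eqP qj0] /eqP qk0].
  by apply: quatP; rewrite slice_ptE !quatE /= ?qi0 ?qj0 ?qk0; ring.
exists (y^-1 *: mkquat 0 (qi q) (qj q) (qk q)).
  apply/imag_unitP; rewrite qnsqZ !quatE mulr0; split=> //.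
  rewrite /qnsq /qdot !mkquatE mulr0 add0r -!expr2 -/n.
  by rewrite -[X in _ * X](sqr_sqrtr n0) -exprMn mulVf // expr1n.
exists (qre q, y); rewrite slice_ptE /= scalerA divff // scale1r.
by apply: quatP; rewrite !quatE; ring.
Qed.

Lemma slice_pt_real J (x : R) : slice_pt J (x, 0) = x%:A.
Proof. by rewrite slice_ptE /= scale0r addr0. Qed.

Lemma slice_pt_opp J z : slice_pt (- J) z = slice_pt J (z.1, - z.2).
Proof. by rewrite !slice_ptE /= scalerN scaleNr. Qed.

Lemma quat_norm_le (q : quat R) : `|q| <= qmod q.
Proof.
rewrite /Num.Def.normr /= mx_normrE; apply/bigmax_leP; split; first exact: qmod_ge0.
by move=> [i j] _ /=; rewrite (ord1 i); exact: coord_le_qmod.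
Qed.

Lemma slice_pt_continuous J : continuous (slice_pt J).
Proof.
move=> z; apply/cvgrPdist_le => e e0.
apply: filterS (sdiff_near (sdiff_slice J z) e0) => u; apply: le_trans.
by rewrite distrC quat_norm_le.
Qed.

Section SymmetricDomain.
Variables (Omega : set (quat R)) (I : quat R).
Hypotheses (dom : slice_domain Omega) (sym : axially_symmetric Omega).
Hypothesis Iu : imag_units I.

(** By symmetry of [Omega] this set does not depend on the unit [I], see
    [profileP]. *)
Definition profile : set (R * R) := slice_pt I @^-1` Omega.

Lemma profileP J z : imag_units J -> profile z <-> Omega (slice_pt J z).
Proof.
by move=> Ju; case: z => x y; split=> [/(sym Iu)|/(sym Ju)]; apply.
Qed.

Lemma profile_flip z : profile z -> profile (z.1, - z.2).
Proof.
by move/(profileP _ (imag_unitN Iu)); rewrite slice_pt_opp.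
Qed.

Lemma profile_open : open profile.
Proof.
have [[oO _] _ _] := dom.
by apply: open_comp oO => z _; exact: slice_pt_continuous.
Qed.

(** The slice plane is a copy of the real plane, of which [phi] is the inverse
    chart; it is continuous on all quaternions, a fortiori on the subspace in
    which the slice is assumed to be connected. *)
Lemma profile_connected : connected profile.
Proof.
have [_ _ /(_ I Iu)[_ cA]] := dom.
pose phi (q : quat R) : R * R := (qre q, qdot q I).
have phiK z : phi (slice_pt I z) = z.
  move/imag_unitP: Iu => [I0]; case: z => x y.
  rewrite /phi slice_ptE /qnsq /qdot !quatE I0 /= => I1; congr pair; first by ring.
  by rewrite -[RHS]mulr1 -I1; ring.
have cre : continuous (@qre R) by exact: coord_continuous.
have ci : continuous (@qi R) by exact: coord_continuous.
have cj : continuous (@qj R) by exact: coord_continuous.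
have ck : continuous (@qk R) by exact: coord_continuous.
have c1 : continuous phi.
  move=> q; have cst (x : R) : (fun=> x) @ nbhs q --> x by exact: cvg_cst.
  have cdot : (fun q => qdot q I) @ nbhs q --> qdot q I.
    exact: (cvgD (cvgD (cvgD (cvgM (cre q) (cst _)) (cvgM (ci q) (cst _)))
      (cvgM (cj q) (cst _))) (cvgM (ck q) (cst _))).
  exact: (cvg_pairT (nbhs_filter q) (cre q) cdot).
have c2 : continuous (phi : subspace (slice_plane I) -> R * R).
  exact: continuous_subspaceT.
have -> : profile = phi @` (Omega `&` slice_plane I).
  apply/seteqP; split=> [z Dz|z [q [Oq [w _ wq]] <-]].
    exists (slice_pt I z); last exact: phiK.
    by split; [exact: Dz | exists z].
  by rewrite -wq phiK /profile /= wq.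
apply: (@connected_continuous_connected (subspace (slice_plane I)) _ _ phi cA).
exact: continuous_subspaceT.
Qed.

Variable f : quat R -> quat R.
Hypothesis f_reg : slice_regular Omega f.

Lemma slice_restr_shol J z : imag_units J -> profile z -> shol J (slice_restr f J) z.
Proof.
move=> Ju /(profileP _ Ju) Oz; have [gC1 CR] := f_reg Ju.
apply: C1_shol gC1 (CR z Oz) => //.
have [[oO _] _ _] := dom.
by apply: open_comp oO => w _; exact: slice_pt_continuous.
Qed.

Let B := stem_re I (slice_restr f I).
Let C := stem_im I (slice_restr f I).

Lemma stem_diffP z : profile z -> stem_diff B C z.
Proof.
move=> Dz; apply: stem_of_shol => //; apply: slice_restr_shol => //.
exact: profile_flip.
Qed.

Lemma stem_flip z : B (z.1, - z.2) = B z /\ C (z.1, - z.2) = - C z.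
Proof.
rewrite /B /C /stem_re /stem_im /= opprK -surjective_pairing addrC; split=> //.
by rewrite -mulrN -mulrN opprB.
Qed.

(** The representation formula.  Both sides are [J]-holomorphic, and on the real
    axis, which all slices share, they agree. *)
Lemma representation J z : imag_units J -> profile z ->
  f (slice_pt J z) = B z + J * C z.
Proof.
move=> Ju Dz; apply/eqP; rewrite -subr_eq0; apply/eqP.
have [_ [x0 Ox0] _] := dom.
have Dx0 : profile (x0, 0) by rewrite /profile /= slice_pt_real.
pose g w := slice_restr f J w - (B w + J * C w).
have gh w : profile w -> shol J g w.
  move=> Dw; apply: sholB; first exact: slice_restr_shol.
  by apply: stem_shol => //; exact: stem_diffP.
apply: (identity_principle Ju profile_open profile_connected gh Dx0 _ Dz).
have [r r0 hr] := near_box (open_nbhs_nbhs (conj profile_open Dx0)).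
apply: (vanish_real Ju r0) => [w /hr /gh //|x _].
rewrite /g /B /C /stem_re /stem_im /slice_restr /= oppr0 !slice_pt_real.
rewrite subrr !mulr0 addr0; move: (f _) => v; apply: quatP; rewrite !quatE; lra.
Qed.

Lemma stem_functions : exists B C : R * R -> quat R,
  [/\ forall z, profile z -> stem_diff B C z,
      forall z, B (z.1, - z.2) = B z /\ C (z.1, - z.2) = - C z &
      forall J z, imag_units J -> profile z -> f (slice_pt J z) = B z + J * C z].
Proof.
by exists B, C; split; [exact: stem_diffP | exact: stem_flip | exact: representation].
Qed.

End SymmetricDomain.
End Stem.

(** * Minimum of the modulus on a sphere *)

Section SphereMinimum.
Variable R : realType.
Implicit Types (I J V a b c : quat R).

(** Every [A = a + V * a * I] satisfies the equation; if they all vanished, [a = 1] would give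
    [V = I], and then [I] would commute with all quaternions. *)
Lemma intertwiner_ex V I : imag_units V -> imag_units I ->
  exists A, [/\ A != 0, 0 <= qre A & V * A + A * I = 0].
Proof.
move=> /imag_unit_mul VV Iu; have II := imag_unit_mul Iu.
suff [a a0] : exists a, a + V * a * I != 0.
  pose A := a + V * a * I.
  have VA : V * A + A * I = 0.
    rewrite /A mulrDr mulrDl !mulrA VV -(mulrA (V * a)) II mulrN1.
    by rewrite !mulN1r mulNr subrKA subrr.
  have [A0|/ltW A0] := leP 0 (qre A); first by exists A.
  exists (- A); rewrite oppr_eq0 quatNE oppr_ge0; split=> //.
  by rewrite mulrN mulNr -opprD VA oppr0.
apply: contrapT => /forallNP none.
have {}none a : V * a * I = - a.
  by apply/eqP; rewrite -addr_eq0 addrC; apply/negPn/negP/none.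
have VI : V = I.
  have := none 1; rewrite mulr1 => /(congr1 (fun q => q * I)).
  by rewrite -mulrA II mulrN1 mulN1r => /oppr_inj.
have comm a : a * I = I * a.
  have := congr1 (fun q => I * q) (none a).
  by rewrite VI !mulrA II mulN1r mulrN mulNr => /oppr_inj.
have [I0 I1] := (imag_unitP I).1 Iu.
have ci := comm (mkquat 0 1 0 0); have cj := comm (mkquat 0 0 1 0).
have e1 := congr1 (@qk R) ci; have e2 := congr1 (@qj R) ci.
have e3 := congr1 (@qk R) cj.
move: I1 e1 e2 e3; rewrite /qnsq /qdot !quatE I0 => I1 e1 e2 e3.
have j0 : qj I = 0 by lra.
have k0 : qk I = 0 by lra.
have i0 : qi I = 0 by lra.
by move/eqP: I1; rewrite i0 j0 k0 !mulr0 !addr0 eq_sym oner_eq0.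
Qed.

(** The hypotheses say that [b + i c] is isotropic, and then [b = V * c] for an
    imaginary unit [V], so that [b + J * c = (V + J) * c].  Along the curve
    [J = u * I * qinv u] with [u = 1 + t *: A], [A] from [intertwiner_ex], one has
    [V + J = (V + I) * qinv u], and the modulus of [u] exceeds 1. *)
Lemma sphere_decrease I b c : imag_units I -> qnsq b = qnsq c -> qdot b c = 0 ->
  b + I * c != 0 -> forall e : R, 0 < e ->
  exists2 J, imag_units J & qmod (J - I) < e /\ qmod (b + J * c) < qmod (b + I * c).
Proof.
move=> Iu bc dbc fp0 e e0.
have c0 : c != 0.
  apply: contraNneq fp0 => c0; move/eqP: bc; rewrite c0 qnsq0 qnsq_eq0 => /eqP ->.
  by rewrite mulr0 addr0.
pose V := b * qinv c.
have Vc : V * c = b by rewrite /V -mulrA qmulVl // mulr1.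
have Vu : imag_units V.
  apply/imag_unitP; split.
    rewrite /V /qinv -scalerAr quatZE; suff -> : qre (b * qconj c) = 0 by rewrite mulr0.
    by rewrite -dbc /qdot !(qconjE, quatE); ring.
  have := congr1 (@qnsq R) Vc; rewrite qnsqM bc => h.
  by apply: (mulIf (_ : qnsq c != 0)); rewrite ?qnsq_eq0 // h mul1r.
have [A [A0 reA VA]] := intertwiner_ex Vu Iu.
(* With this [t], [qmod (J - I) <= 2 * t * qmod A < e] below. *)
pose t := e / (2 * qmod A + 1).
have den : 0 < 2 * qmod A + 1 by have := qmod_ge0 A; lra.
have t0 : 0 < t by rewrite divr_gt0.
pose u := 1 + t *: A.
have u1 : 1 < qmod u.
  rewrite -ltr_sqr ?nnegrE ?qmod_ge0 // expr1n qmod_sqr.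
  have -> : qnsq u = 1 + 2 * (t * qre A) + t ^+ 2 * qnsq A.
    by rewrite /u /qnsq /qdot !quatE; ring.
  have h1 : 0 < t ^+ 2 * qnsq A.
    by rewrite mulr_gt0 ?exprn_gt0 // lt_def qnsq_eq0 A0 qnsq_ge0.
  have h2 : 0 <= t * qre A by rewrite mulr_ge0 // ltW.
  lra.
have u0 : u != 0 by rewrite -qmod_gt0 (lt_trans _ u1).
pose J := u * I * qinv u; exists J; first exact: imag_unit_conjg.
split.
  have -> : J - I = t *: ((A * I - I * A) * qinv u).
    have uI : u * I - I * u = t *: (A * I - I * A) by rewrite /u; qring.
    rewrite scalerAl -uI mulrBl -/J; congr (_ - _).
    by rewrite -mulrA qmulV // mulr1.
  rewrite qmodZ gtr0_norm // qmodM qmod_inv.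
  have le : qmod (A * I - I * A) <= 2 * qmod A.
    apply: le_trans (qmodB_le _ _) _.
    by rewrite !qmodM (imag_unit_mod Iu) mul1r mulr1 mulr_natl mulr2n.
  apply: (@le_lt_trans _ _ (t * (2 * qmod A))).
    apply: ler_wpM2l; first exact: ltW.
    apply: le_trans le; apply: ler_piMr; first exact: qmod_ge0.
    by rewrite invf_le1 ?(lt_trans _ u1) // ltW.
  by rewrite /t mulrAC ltr_pdivrMr // ltr_pM2l // ltrDl.
have -> : b + J * c = (V + I) * qinv u * c.
  rewrite -{1}Vc -mulrDl; congr (_ * _).
  have uVI : V * u + u * I = V + I.
    rewrite /u mulrDr mulrDl mulr1 mul1r addrACA -scalerAl -scalerAr -scalerDr VA.
    by rewrite scaler0 addr0.
  by rewrite -uVI mulrDl -/J -mulrA qmulV // mulr1.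
have fE : b + I * c = (V + I) * c by rewrite mulrDl Vc.
rewrite fE !qmodM qmod_inv mulrAC gtr_pMr; last first.
  by rewrite -qmodM qmod_gt0 -fE.
by rewrite invf_lt1 // (lt_trans _ u1).
Qed.

End SphereMinimum.

(** * Reciprocals and the minimum principle *)

Section Reciprocal.
Variable R : realType.
Implicit Types (z w : R * R) (D : set (R * R)) (I J b c : quat R).

Lemma qdotZZ (x y : R) c : qdot (x *: c) (y *: c) = x * y * qnsq c.
Proof. by rewrite /qnsq /qdot !quatE; ring. Qed.

(** Real and imaginary parts of the symmetrization [(b + i c) (b' + i c')],
    where [b'] and [c'] are the conjugates of [b] and [c].  Its squared modulus is
    the product of the extrema of [qnsq (b + J * c)] over the units [J]. *)
Definition symm b c : R * R := (qnsq b - qnsq c, 2 * qdot b c).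

Lemma symmE J b c : imag_units J ->
  (qconj b + J * qconj c) * b + J * ((qconj b + J * qconj c) * c) =
  slice_pt J (symm b c).
Proof.
move=> /imag_unit_mul JJ.
have -> : slice_pt J (symm b c) =
    qconj b * b - qconj c * c + J * (qconj c * b + qconj b * c).
  rewrite !qconj_mul slice_ptE /symm /=; have -> : qconj c * b + qconj b * c =
    (2 * qdot b c)%:A by rewrite /qdot; qring.
  by rewrite -scalerAr mulr1 scalerBl.
rewrite !mulrDl !mulrDr !mulrA JJ mulN1r mulNr.
move: (qconj b * b) (qconj c * c) (J * qconj c * b) (J * qconj b * c) => *; qring.
Qed.

Lemma symm_shol J (B C : R * R -> quat R) z : imag_units J -> stem_diff B C z ->
  shol J (fun u => slice_pt J (symm (B u) (C u))) z.
Proof.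
move=> Ju sBC; have [d dG] := stem_shol Ju (stem_conj sBC).
have [b [c [dB dC]]] := sBC; have JJ := imag_unit_mul Ju.
have dN := sdiffD (sdiffM dG dB) (sdiffMl J (sdiffM dG dC)).
pose G z := qconj (B z) + J * qconj (C z).
exists (d * B z + G z * b + J * (d * C z + G z * c)).
have -> : J * (d * B z + G z * b + J * (d * C z + G z * c)) =
   J * d * B z + G z * (- c) + J * (J * d * C z + G z * b).
  rewrite !mulrDr !mulrA JJ !mulN1r mulrN !mulNr.
  move: (J * d * B z) (J * G z * b) (d * C z) (G z * c) => *; qring.
by apply: sdiff_ext dN; near=> u; exact: symmE.
Unshelve. all: by end_near. Qed.

(** If [g] is the value at [x + y J] of the conjugate function, the value of [f]
    at the point [x + y K] with [K = twist J g] is [qinv g] times the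
    symmetrization: this is how the reciprocal of a slice function is related to
    the pointwise reciprocal, see [twist_mul]. *)
Definition twist J g : quat R := qinv g * J * g.

Lemma twist_unit J g : g != 0 -> imag_units J -> imag_units (twist J g).
Proof.
move=> g0 /imag_unit_mul JJ; rewrite /imag_units /= expr2.
have -> : twist J g * twist J g = qinv g * (J * (g * qinv g) * J) * g.
  by rewrite /twist !mulrA.
by rewrite qmulV // mulr1 JJ mulrN1 mulNr qmulVl.
Qed.

Lemma twist_mul J g b c : g != 0 ->
  b + twist J g * c = qinv g * (g * b + J * (g * c)).
Proof. by move=> g0; rewrite mulrDr /twist !mulrA qmulVl // mul1r. Qed.

(** To reach a prescribed unit [I], twist with the conjugate [J] of [I] by
    [qconj (b + I * c)]: its relation to [d] passes on to [g]. *)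
Lemma twist_eq J I b c : imag_units J -> imag_units I ->
  let d := qconj (b + I * c) in let g := qconj b + J * qconj c in
  J * d = d * I -> g != 0 -> twist J g = I.
Proof.
move=> Ju Iu d g; rewrite /d qconjD qconjM (imag_unit_conj Iu) mulrN => h g0.
suff Jg : J * g = g * I by rewrite /twist -mulrA Jg mulrA qmulVl // mul1r.
move: h; rewrite mulrBr mulrBl -[X in _ = _ - X]mulrA.
rewrite (imag_unit_mul Iu) mulrN1 opprK => /eqP; rewrite subr_eq => /eqP h.
rewrite /g mulrDr (mulrA J J) (imag_unit_mul Ju) mulN1r mulrDl h.
by rewrite addrAC addrK !mulrA.
Qed.

Lemma twist_near J (G : R * R -> quat R) b c z (e : R) : sdiff G z b c -> G z != 0 ->
  0 < e -> \forall w \near z,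
    qmod (slice_pt (twist J (G w)) w - slice_pt (twist J (G z)) z) <= e.
Proof.
move=> sG Gz e0.
have sK := sdiffM (sdiffM (sdiffV Gz sG) (sdiff_cst J z)) sG.
have sx : sdiff (fun z => z.1%:A) z (1 : quat R) 0.
  move=> x x0; near=> uv; have -> : uv.1.1%:A - uv.2.1%:A -
    qlin (1 : quat R) 0 (uv.1 - uv.2) = 0 by rewrite /qlin /=; qring.
  by rewrite qmod0 mulr_ge0 // ltW.
have sy : sdiff (fun z => z.2%:A) z 0 (1 : quat R).
  move=> x x0; near=> uv; have -> : uv.1.2%:A - uv.2.2%:A -
    qlin 0 (1 : quat R) (uv.1 - uv.2) = 0 by rewrite /qlin /=; qring.
  by rewrite qmod0 mulr_ge0 // ltW.
have := sdiff_near (sdiffD sx (sdiffM sy sK)) e0.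
by apply: filterS => w; rewrite !mulr_algl.
Unshelve. all: by end_near. Qed.

Lemma conj_pair_solve J b c h (x y : R) : imag_units J ->
  b + J * c = slice_pt J (x, y) * h -> b - J * c = slice_pt J (x, - y) * h ->
  b = x *: h /\ c = y *: h.
Proof.
move=> Ju; rewrite !slice_ptE /= !mulrDl -!scalerAl !mul1r scaleNr => e1 e2.
have two (q : quat R) : q = 2^-1 *: (q + q) by apply: quatP; rewrite !quatE; lra.
split.
  rewrite [LHS]two [RHS]two; congr (_ *: _).
  have -> : b + b = (b + J * c) + (b - J * c) by move: (J * c) => *; qring.
  by rewrite e1 e2; qring.
have Jc : J * c = y *: (J * h).
  rewrite [LHS]two [RHS]two; congr (_ *: _).
  have -> : J * c + J * c = (b + J * c) - (b - J * c) by move: (J * c) => *; qring.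
  by rewrite e1 e2; move: (J * h) => *; qring.
have := congr1 (fun q => - J * q) Jc.
by rewrite -scalerAr !mulNr !mulrA (imag_unit_mul Ju) !mulN1r !opprK.
Qed.

(** In complex notation the hypotheses read [w = k * w ^ 2] with [w = x + i y]. *)
Lemma symm_fixed (x y k : R) : 0 < k -> x = (x ^+ 2 - y ^+ 2) * k ->
  y = 2 * x * y * k -> y = 0 /\ (x = 0 \/ x * k = 1).
Proof.
move=> k0 hx hy.
have y0 : y = 0.
  apply/eqP/negPn/negP => y0.
  have xk : 2 * x * k = 1 by apply: (mulIf y0); rewrite mul1r [RHS]hy; ring.
  have : 0 < y ^+ 2 * k ^+ 2.
    by apply: mulr_gt0; [rewrite lt_def sqrf_eq0 y0 sqr_ge0 | exact: exprn_gt0].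
  have e : x * k = (x * k) ^+ 2 - y ^+ 2 * k ^+ 2 by rewrite {1}hx; ring.
  have xk2 : x * k = 2^-1 by lra.
  by rewrite xk2 in e; nra.
split=> //; have [->|x0] := eqVneq x 0; [by left | right].
by apply: (mulfI x0); rewrite mulr1 [RHS]hx y0; ring.
Qed.

End Reciprocal.

Section Minimum.
Variable R : realType.
Variables (Omega : set (quat R)) (f : quat R -> quat R) (p : quat R).
Hypothesis (dom : slice_domain Omega) (sym : axially_symmetric Omega).
Hypothesis f_reg : slice_regular Omega f.
Hypothesis p_min : local_min_on Omega (fun q => qmod (f q)) p.
Hypothesis fp0 : f p != 0.

Lemma minimum_ball : exists2 r : R, 0 < r & forall q, Omega q -> qmod (q - p) < r ->
  qmod (f p) <= qmod (f q).
Proof.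
have [_ /nbhs_normP[r /= r0 hr]] := p_min.
exists r => // q Oq qr; apply: hr => //=; rewrite distrC.
by apply: le_lt_trans qr; exact: quat_norm_le.
Qed.

(** Let [p] be the point [z0] of the slice of [I], and [G = B' + J * C'] the
    conjugate function on the slice of the unit [J] for which
    [twist J (G z0) = I], with [B'] and [C'] the conjugates of [B] and [C].  Since
    [f] at the twisted point is [qinv G * N], the local minimum of [qmod f] at [p]
    turns into a local maximum of the modulus of [H = qinv N * G], the reciprocal
    of [f] on the slice of [J].  By the strong maximum principle [H] is a constant
    [h0] near [z0], whence [G = N * h0] on the whole slice.  Comparing conjugate
    points, [B'] and [C'] are real multiples of
    [h0] with the coordinates of [N] as coefficients.  As [N] was built from [B]
    and [C], this leaves for its coordinates only 0 or [(qnsq h0)^-1], and 0; the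
    first is not 0 near [z0], so by the identity principle it is never 0. *)
Theorem constant_of_minimum : constant_on Omega f.
Proof.
have [r r0 hr] := minimum_ball; have [Op _] := p_min.
have [I Iu [z0 pE]] := slice_decomposition p.
set D := profile Omega I.
have Dz0 : D z0 by rewrite /D /profile /= -pE.
have [B [C [stem flip rep]]] := stem_functions dom sym Iu f_reg.
have inO J z : imag_units J -> D z -> Omega (slice_pt J z).
  by move=> Ju Dz; exact/(profileP sym Iu z Ju).
have oD : open D by exact: profile_open.
have cD : connected D := profile_connected dom Iu.
have fpE : f p = B z0 + I * C z0 by rewrite pE rep.
pose S z := symm (B z) (C z).
(* Otherwise the sphere through [p] carries a zero of [f], and [qmod f] has no
   local minimum on it except at that zero. *)
have S0 : S z0 != 0.
  apply/eqP => -[/eqP]; rewrite subr_eq0 => /eqP h1 /eqP.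
  rewrite mulf_eq0 pnatr_eq0 /= => /eqP h2.
  have fp1 : B z0 + I * C z0 != 0 by rewrite -fpE.
  have den : 0 < `|z0.2| + 1 by rewrite ltr_wpDl.
  have e0 : 0 < r / (`|z0.2| + 1) by rewrite divr_gt0.
  have [J Ju [JI lt]] := sphere_decrease Iu h1 h2 fp1 e0.
  have : qmod (f p) <= qmod (f (slice_pt J z0)).
    apply: hr; first exact: inO.
    have -> : slice_pt J z0 - p = z0.2 *: (J - I) by rewrite pE !slice_ptE; qring.
    rewrite qmodZ; apply: (@le_lt_trans _ _ ((`|z0.2| + 1) * qmod (J - I))).
      by rewrite ler_wpM2r ?qmod_ge0 // lerDl.
    by rewrite mulrC -ltr_pdivlMr.
  by rewrite fpE rep // leNgt lt.
pose d := qconj (f p).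
have d0 : d != 0 by rewrite -qmod_eq0 qmod_conj qmod_eq0.
have [J Ju Jd] : exists2 J, imag_units J & J * d = d * I.
  by exists (d * I * qinv d); [exact: imag_unit_conjg | rewrite -mulrA qmulVl // mulr1].
pose G z := qconj (B z) + J * qconj (C z).
pose N z := slice_pt J (S z).
have NE z : G z * B z + J * (G z * C z) = N z by exact: symmE.
have N0 : N z0 != 0 by apply: contraNneq S0 => /(slice_pt_eq0 Ju) ->.
have G_neq0 z : N z != 0 -> G z != 0.
  by apply: contraNneq => G0; rewrite -NE G0 !mul0r mulr0 addr0.
have Gh z : D z -> shol J G z by move=> Dz; apply: stem_shol Ju (stem_conj (stem z Dz)).
have Nh z : D z -> shol J N z by move=> Dz; apply: symm_shol Ju (stem z Dz).
have Ncomm z : GRing.comm (N z) J by exact: slice_pt_comm.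
pose K z := twist J (G z).
have Ku z : N z != 0 -> imag_units (K z).
  by move=> /G_neq0 Gz; exact: twist_unit.
have KE z : D z -> N z != 0 -> f (slice_pt (K z) z) = qinv (G z) * N z.
  move=> Dz Nz; rewrite rep //; last exact: Ku.
  by rewrite -NE /K twist_mul // G_neq0.
have K0 : K z0 = I.
  by apply: (@twist_eq _ J I (B z0) (C z0) Ju Iu _ (G_neq0 _ N0)); rewrite -fpE.
have nD : \forall z \near z0, D z by exact: (open_nbhs_nbhs (conj oD Dz0)).
have nN : \forall z \near z0, N z != 0.
  have [b sb] := Nh z0 Dz0; have m0 : 0 < qmod (N z0) / 2.
    by rewrite divr_gt0 // qmod_gt0.
  apply: filterS (sdiff_near sb m0) => z; apply: contraTneq => ->.
  rewrite sub0r qmodN -ltNge ltr_pdivrMr // ltr_pMr ?qmod_gt0 //.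
  by rewrite ltr1n.
have near_p : \forall z \near z0, qmod (slice_pt (K z) z - p) < r.
  have [b sG] := Gh z0 Dz0.
  have r2 : 0 < r / 2 by rewrite divr_gt0.
  have nK : \forall z \near z0,
      qmod (slice_pt (K z) z - slice_pt (K z0) z0) <= r / 2.
    exact: (twist_near J sG (G_neq0 _ N0) r2).
  apply: filterS nK => z; rewrite K0 -pE => /le_lt_trans; apply.
  by rewrite ltr_pdivrMr // ltr_pMr // ltr1n.
pose H z := qinv (N z) * G z.
have Hmod z : qmod (H z) = qmod (G z) / qmod (N z) by rewrite qmodM qmod_inv mulrC.
have fmod z : D z -> N z != 0 -> qmod (f (slice_pt (K z) z)) = (qmod (H z))^-1.
  by move=> Dz Nz; rewrite KE // qmodM qmod_inv Hmod invf_div mulrC.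
have nH : \forall z \near z0, shol J H z.
  apply: filterS2 nD nN => z Dz Nz; apply: sholM; last exact: Gh.
    exact: qinv_comm.
  by apply: sholV => //; exact: Nh.
have H_gt0 z : N z != 0 -> 0 < qmod (H z).
  by move=> Nz; rewrite Hmod divr_gt0 // qmod_gt0 // G_neq0.
have fpH : qmod (f p) = (qmod (H z0))^-1 by rewrite -fmod // K0 -pE.
have Hmax : \forall z \near z0, qmod (H z) <= qmod (H z0).
  apply: filterS3 nD nN near_p => z Dz Nz zp.
  have := hr _ (inO _ _ (Ku _ Nz) Dz) zp; rewrite fpH fmod //.
  move: (qmod (H z)) (H_gt0 z Nz) (qmod (H z0)) (H_gt0 z0 N0) => x x0 y y0.
  by rewrite lef_pV2.
have nHc := strong_maximum Ju nH Hmax.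
set h0 := H z0 in nHc; pose k := qnsq h0.
have k0 : 0 < k by rewrite /k -qmod_sqr exprn_gt0 // H_gt0.
have GN z : D z -> G z = N z * h0.
  move=> Dz; apply/eqP; rewrite -subr_eq0; apply/eqP.
  apply: (@identity_principle _ _ Ju (fun z => G z - N z * h0) _ z0 oD cD _ Dz0 _ z Dz).
    by move=> w Dw; apply: sholB; [exact: Gh | apply: sholMr; exact: Nh].
  by apply: filterS2 nN nHc => w Nw <-; rewrite /H mulrA qmulV // mul1r subrr.
have BC z : D z -> qconj (B z) = (S z).1 *: h0 /\ qconj (C z) = (S z).2 *: h0.
  move=> Dz; have Dzf := profile_flip sym Iu Dz; have [Bf Cf] := flip z.
  have e1 := GN _ Dz; have e2 := GN _ Dzf.
  have Sf : S (z.1, - z.2) = ((S z).1, - (S z).2).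
    rewrite /S /symm Bf Cf; congr pair.
      by rewrite /= /qnsq /qdot !quatE; ring.
    by rewrite /= /qdot !quatE; ring.
  have e2' : qconj (B z) - J * qconj (C z) = slice_pt J ((S z).1, - (S z).2) * h0.
    by rewrite -Sf -/(N _) -e2 /G Bf Cf qconjN mulrN.
  by apply: conj_pair_solve Ju _ e2'; rewrite -surjective_pairing -/(N z) -e1.
have Sfix z : D z -> (S z).2 = 0 /\ ((S z).1 = 0 \/ (S z).1 * k = 1).
  move=> Dz; have [hB hC] := BC z Dz.
  have : S z = symm (qconj (B z)) (qconj (C z)).
    rewrite /S /symm !qnsq_conj; congr (_, _).
    by rewrite /qdot !qconjE; ring.
  rewrite hB hC; move: (S z) => [x y] [hx hy]; apply: symm_fixed k0 _ _ => /=.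
    by rewrite [LHS]hx /= !qnsqZ /k; ring.
  by rewrite [LHS]hy /= qdotZZ /k; ring.
have Nconst z : D z -> N z - (k^-1)%:A = 0.
  apply: (@identity_principle _ _ Ju (fun z => N z - (k^-1)%:A) _ z0 oD cD _ Dz0).
    by move=> w Dw; apply: sholB; [exact: Nh | exact: shol_cst].
  apply: filterS2 nD nN => w Dw; have [Sw2 Sw1] := Sfix w Dw.
  rewrite /N slice_ptE Sw2 scale0r addr0; case: Sw1 => [->|Sw1 _].
    by rewrite scale0r eqxx.
  have -> : (S w).1 = k^-1 by apply: (mulIf (lt0r_neq0 k0)); rewrite Sw1 mulVf ?gt_eqF.
  exact: subrr.
have S1 z : D z -> (S z).1 = k^-1.
  move=> Dz; have [Sz2 _] := Sfix z Dz; move: (Nconst z Dz).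
  rewrite /N slice_ptE Sz2 scale0r addr0 -scalerBl => /(congr1 (@qre R)).
  by rewrite !quatE mulr1 => /eqP; rewrite subr_eq0 => /eqP.
exists (qconj (k^-1 *: h0)) => q Oq; have [I' Iu' [z qE]] := slice_decomposition q.
have Dz : D z by apply/(profileP sym Iu z Iu'); rewrite -qE.
have [hB hC] := BC z Dz; have [Sz2 _] := Sfix z Dz.
rewrite qE (rep _ _ Iu' Dz) -[B z]qconjK -[C z]qconjK hB hC Sz2 S1 // scale0r.
by rewrite [qconj 0](_ : _ = 0) ?mulr0 ?addr0 //; qring.
Qed.

End Minimum.

Theorem theorem1p15 (R : realType) (Omega : set (quat R))
    (f : quat R -> quat R) (p : quat R)
    (Omega_slice : slice_domain Omega)
    (Omega_sym : axially_symmetric Omega)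
    (f_reg : slice_regular Omega f)
    (p_min : local_min_on Omega (fun q => qmod (f q)) p) :
  f p = 0 \/ constant_on Omega f.
Proof.
have [->|fp0] := eqVneq (f p) 0; [by left | right].
exact: (constant_of_minimum Omega_slice Omega_sym f_reg p_min fp0).
Qed.
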